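(* For every convex polygon $P$ with $n > 3$ vertices there exists a triangulation of $P$ that simultaneously minimizes the dual diameter among all triangulations of $P$ and maximizes the number of ears among all triangulations of $P$.
   Context: A simple polygon $P$ is regarded as a closed two-dimensional subset of the plane, including its boundary. A triangulation $T$ of $P$ is a maximal crossing-free straight-line graph whose vertices are the vertices of $P$ and whose edges lie inside $P$; all its bounded faces are triangles. The dual graph $T^*$ has one vertex for each bounded face (triangle) of $T$ and an edge between two vertices if and only if the corresponding triangles share an edge of $T$; it is a tree. The dual diameter of $T$ is the graph diameter of $T^*$. An ear of $T$ is a triangle whose vertex in $T^*$ is a leaf (equivalently, exactly two of its three edges are edges of $P$). *)

(* Defs.v *)
From HB Require Import structures.
From mathcomp Require Import all_boot all_order all_algebra.
From mathcomp Require Import all_classical all_reals all_analysis.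

Set Implicit Arguments.
Unset Strict Implicit.
Unset Printing Implicit Defensive.

Import Order.TTheory GRing.Theory Num.Theory.
Import numFieldNormedType.Exports.

Local Open Scope classical_set_scope.
Local Open Scope ring_scope.

Section GraphMetric.
Variables (V : finType) (e : rel V).

Definition has_walk (k : nat) (x y : V) : bool :=
  [exists p : k.-tuple V, path e x p && (last x p == y)].

(* Length of a shortest walk.  Shortest walks have length less than #|V|;
   the value #|V| means that y is not reachable from x. *)
Definition graph_dist (x y : V) : nat :=
  find (fun k => has_walk k x y) (iota 0 #|V|).

Definition graph_diameter (W : {set V}) : nat :=
  (\max_(x in W) \max_(y in W) graph_dist x y)%N.

End GraphMetric.

Section Triangulation.
Variables (R : realType) (n : nat).
Implicit Types (P F : set (R * R)) (v : 'I_n -> R * R).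
Implicit Types (A e s t : {set 'I_n}) (T : {set {set 'I_n}}).

(* Convex hull of the points v i, i \in A.  In particular it is a closed
   segment when A has two elements and a closed triangle when A has three. *)
Definition hull v A : set (R * R) :=
  [set x | exists w : 'I_n -> R,
     [/\ forall i, 0 <= w i,
         \sum_(i in A) w i = 1
       & x = \sum_(i in A) w i *: v i]].

(* P is the convex hull of the v i, and each v i is a vertex of P (it is not in
   the hull of the others), so that P has exactly n vertices.  The labelling
   need not follow the boundary of P. *)
Definition convex_polygon P v : Prop :=
  P = hull v [set: 'I_n]%SET /\ forall i, ~ hull v [set~ i]%SET (v i).

(* A straight-line graph on the v i is the set T of its edges, an edge being
   a pair of labels drawn as the segment hull v e.  Distinct edges may meet
   only at a common endpoint. *)
Definition crossing_free_graph_in P v T : Prop :=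
  [/\ forall e, e \in T -> #|e| = 2%N,
      forall e, e \in T -> hull v e `<=` P
    & forall e f, e \in T -> f \in T -> e != f ->
        hull v e `&` hull v f `<=` v @` [set` (e :&: f)%SET]].

Definition triangulation P v T : Prop :=
  crossing_free_graph_in P v T /\
  forall T', crossing_free_graph_in P v T' -> T \subset T' -> T' = T.

Definition drawing v T : set (R * R) :=
  \bigcup_(e in [set` T]) hull v e.

Definition bounded_face v T F : Prop :=
  bounded_set F /\
  exists2 x, (~` drawing v T) x & F = connected_component (~` drawing v T) x.

(* All bounded faces of a triangulation are triangles.  Such a face is
   represented by its set t of corners; the face itself is the open triangle
   interior (hull v t).  These are the vertices of the dual graph. *)
Definition triangles v T : {set {set 'I_n}} :=
  [set t : {set 'I_n} |
     (#|t| == 3%N) && `[< bounded_face v T (interior (hull v t)) >]]%SET.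

Definition dual_adj v T : rel {set 'I_n} := fun s t =>
  [&& s \in triangles v T, t \in triangles v T, s != t
    & [exists e in T, (e \subset s) && (e \subset t)]].

Definition dual_diameter v T : nat :=
  graph_diameter (dual_adj v T) (triangles v T).

Definition ears v T : {set {set 'I_n}} :=
  [set t in triangles v T | #|[set s | dual_adj v T t s]| == 1%N]%SET.

End Triangulation.

(* Main.v *)
Require Import Defs.
From mathcomp Require Import all_boot all_order all_algebra.
From mathcomp Require Import all_classical all_reals all_analysis.
From mathcomp Require Import ring lra zify.

(** Listing the vertices counterclockwise, two edges cross exactly when their
    endpoints interleave, so triangulations of an n-gon are the maximal families
    of non-interleaving pairs, and their faces are the triples all of whose pairs
    are edges.  Rooting at one side of the polygon identifies triangulations with
    binary trees with n - 1 leaves: the dual diameter becomes the diameter of the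
    tree, and the ears become the inner nodes with two leaf children ("cherries"),
    plus the root if one of its children is a leaf.

    There are at most n / 2 ears, and n <= size_bound D for a tree of diameter D.
    For the least D allowed by that inequality, a tree with diameter at most D and
    n / 2 ears is obtained by grafting balanced trees with a power of two leaves
    along a spine, all but one leaf being paired in cherries. *)

Set Implicit Arguments.
Unset Strict Implicit.
Unset Printing Implicit Defensive.

(** * Binary trees *)

(** The two optima are compatible for a parity reason. Two ears share no side of the polygon and
    each uses up two sides, so n / 2 bounds their number; pairing the leaves in cherries attains it,
    with at most one leaf left over. The size bound comes from a chain of siblings: a subtree of
    height D / 2 + 1 has at most 2 ^ (D / 2 + 1) leaves, and each step up to height h admits only a
    sibling of height at most D + 1 - h, so the gains are decreasing powers of two with sum below 2
    ^ (D - D / 2). Powers above 1 are even and pair up without loss; the last one, 2 ^ 0, is a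
    single leaf at the root, where it makes the root an ear. Heights are controlled along with
    diameters because a tree must have height at most D to accept that leaf. Faces are topological
    components, so identifying them with triples needs an argument in each direction. Dual distances
    are bounded below by an integer potential that changes by at most one along dual edges, which
    avoids any discussion of unique paths. *)

Inductive btree := Leaf | Node of btree & btree.

Fixpoint leaves b := if b is Node l r then leaves l + leaves r else 1.

Fixpoint height b :=
  if b is Node l r then (maxn (height l) (height r)).+1 else 0.

(** [height] counts inner nodes along a branch, so a longest path through the root of [Node l r] has
    [height l + height r] dual edges. *)
Fixpoint diam b :=
  if b is Node l r then maxn (height l + height r) (maxn (diam l) (diam r))
  else 0.

Fixpoint cherries b :=
  if b is Node l r then
    if leaves l + leaves r == 2 then 1 else cherries l + cherries r
  else 0.

Definition root_ear b :=
  if b is Node l r then (leaves l == 1) || (leaves r == 1) else false.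

Lemma leaves_gt0 b : 0 < leaves b.
Proof. by elim: b => //= l Hl r Hr; lia. Qed.

Lemma leaves_gt1P b : 1 < leaves b -> exists l r, b = Node l r.
Proof. by case: b => // l r _; exists l, r. Qed.

Lemma leaves_eq1 b : leaves b = 1 -> b = Leaf.
Proof.
by case: b => //= l r; have := leaves_gt0 l; have := leaves_gt0 r; lia.
Qed.

Lemma height_lt_leaves b : height b < leaves b.
Proof. by elim: b => //= l Hl r Hr; lia. Qed.

Lemma diam_lt_leaves b : diam b < leaves b.
Proof.
elim: b => //= l Hl r Hr.
by have := height_lt_leaves l; have := height_lt_leaves r; lia.
Qed.

Lemma diam_le_height b : diam b <= (height b).-1.*2.
Proof. by elim: b => //= l Hl r Hr; lia. Qed.

Lemma leaves_le_exp b : leaves b <= 2 ^ height b.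
Proof.
elim: b => //= l Hl r Hr.
rewrite expnS mul2n -addnn leq_add //; [apply: leq_trans Hl _|apply: leq_trans Hr _];
  by rewrite leq_exp2l // (leq_maxl, leq_maxr).
Qed.

(* One more than the largest number of leaves of a binary tree of diameter
   D: it is 3 * 2 ^ k for D = 2 * k and 4 * 2 ^ k for D = 2 * k + 1. *)
Definition size_bound D := 2 ^ (D./2).+1 + 2 ^ (D - D./2).

(** The summand [2 ^ (D.+1 - height b)] is room reserved for siblings higher up. If the taller child
    [l] is itself above [D./2], its sibling has height at most [D - height l], which consumes at
    most half of the room reserved for [l]; the other half remains. The induction starts where both
    children have height at most [D./2]. *)
Lemma leaves_height_bound b D : diam b <= D -> D./2 < height b ->
  leaves b + 2 ^ (D.+1 - height b) <= size_bound D.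
Proof.
rewrite /size_bound; set k := D./2; elim: b => //= l Hl r Hr.
wlog: l r Hl Hr / height r <= height l.
  move=> H; case/orP: (leq_total (height r) (height l)) => hlr; first exact: H Hl Hr hlr.
  by rewrite (addnC (height l)) (addnC (leaves l)) (maxnC (height l))
       (maxnC (diam l)); exact: H Hr Hl hlr.
move=> hrl; rewrite (maxn_idPl hrl) !geq_max => /and3P[hD dl dr] hk.
have lvl := leaves_le_exp l; have lvr := leaves_le_exp r.
case: (ltnP k (height l)) => hkl.
  have := Hl dl hkl.
  have -> : D.+1 - height l = (D - height l).+1 by lia.
  rewrite subSS expnS => IH.
  have : leaves r <= 2 ^ (D - height l).
    by apply: leq_trans lvr _; rewrite leq_exp2l //; lia.
  lia.
have -> : height l = k by lia.
rewrite subSS expnS.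
have : leaves l <= 2 ^ k by apply: leq_trans lvl _; rewrite leq_exp2l //; lia.
have : leaves r <= 2 ^ k by apply: leq_trans lvr _; rewrite leq_exp2l //; lia.
lia.
Qed.

Lemma leaves_diam_bound b : (leaves b).+1 <= size_bound (diam b).
Proof.
case: (ltnP (diam b)./2 (height b)) => h.
  have := leaves_height_bound (leqnn _) h.
  have : 0 < 2 ^ ((diam b).+1 - height b) by rewrite expn_gt0.
  lia.
have := leaves_le_exp b.
have : 2 ^ height b <= 2 ^ (diam b)./2 by rewrite leq_exp2l.
have : 0 < 2 ^ (diam b - (diam b)./2) by rewrite expn_gt0.
rewrite /size_bound expnS; lia.
Qed.

(** Filling the left child completely before the right one keeps the left count even, so at most one
    leaf of the whole tree stays outside the cherries. *)
Lemma balanced_tree h m : 0 < m <= 2 ^ h ->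
  exists b, [/\ leaves b = m, height b <= h & cherries b = m./2].
Proof.
elim: h m => [|h IH] m /andP[m0 mh].
  by exists Leaf; split=> //=; rewrite ?expn0 in mh; lia.
case: (leqP m (2 ^ h)) => hm.
  by have [|b [? ? ?]] := IH m; [lia|exists b; split=> //; lia].
have [|l [ll hl cl]] := IH (2 ^ h); first by rewrite leqnn expn_gt0.
have [|r [lr hr cr]] := IH (m - 2 ^ h); first by rewrite expnS in mh; lia.
exists (Node l r); split=> /=; [lia|lia|].
rewrite ll lr cl cr; case: ifP => [|m2]; first by move/eqP; lia.
(* For [h = 0] the split is 1 + 1, the cherry excluded by [m2]; otherwise [2 ^ h] is even and the
   two halves add up. *)
case: h hm mh m2 {IH hl hr ll cl lr cr} => [|h]; first by rewrite !expnS !expn0; lia.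
by rewrite !expnS; lia.
Qed.

(** Converse to [leaves_height_bound]: the inequality there is also sufficient, even with the leaves
    paired. Raising the height bound by one allows one more full subtree to be grafted at the
    root. *)
Lemma spine_tree D m E : D./2 < m <= D \/ m = (D./2).+1 ->
  0 < E -> E + 2 ^ (D.+1 - m) <= size_bound D ->
  exists b, [/\ leaves b = E, height b <= m, diam b <= D & cherries b = E./2].
Proof.
rewrite /size_bound; set k := D./2 => hm.
have {hm} [j -> jD] : exists2 j, m = k.+1 + j & j = 0 \/ k.+1 + j <= D.
  by exists (m - k.+1); lia.
elim: j jD E => [|j IH] jD E E0.
  rewrite addn0 subSS => EB.
  (* At the base height the inequality reduces to [E <= 2 ^ k.+1], and height [k.+1] forces diameter
     at most [2 * k <= D]. *)
  have [|b [lb hb cb]] := @balanced_tree k.+1 E; first by lia.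
  by exists b; split=> //; have := diam_le_height b; lia.
have {}jD : k.+1 + j < D by lia.
have {}IH := IH (or_intror (ltnW jD)).
have -> : D.+1 - (k.+1 + j.+1) = D - (k.+1 + j) by lia.
have e1 : D.+1 - (k.+1 + j) = (D - (k.+1 + j)).+1 by lia.
set d := D - (k.+1 + j) in e1 *; rewrite e1 expnS in IH => EB.
(* With room to spare the tree for the smaller height bound serves; otherwise [E] is large enough to
   hand [2 ^ d] leaves to a full sibling of height [d]. *)
case: (leqP (E + 2 * 2 ^ d) (2 ^ k.+1 + 2 ^ (D - k))) => EB'.
  by have [|b [? ? ? ?]] := IH E E0; [lia|exists b; split=> //; lia].
have dk : 2 ^ d <= 2 ^ k by rewrite leq_exp2l //; lia.
have dk' : 2 ^ d <= 2 ^ (D - k) by rewrite leq_exp2l //; lia.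
have Ed : 2 ^ d < E by rewrite expnS in EB'; lia.
have kD : k = D./2 by [].
(* As [d] is positive, [2 ^ d] is even and subtracting it from [E] is compatible with halving. *)
have hd : exists d', d = d'.+1 by exists d.-1; lia.
have [||l [ll hl dl cl]] := IH (E - 2 ^ d); [lia|lia|].
have [|r [lr hr cr]] := @balanced_tree d (2 ^ d); first by rewrite leqnn expn_gt0.
have := diam_le_height r => dr.
exists (Node l r); rewrite /= ll lr cl cr; split; [lia|lia|lia|].
case: hd => d' dE; rewrite dE expnS in Ed *; case: ifP => [/eqP|_]; last by lia.
by have : 0 < 2 ^ d' by [rewrite expn_gt0]; lia.
Qed.

Lemma cherries_le b : (cherries b).*2 <= leaves b.
Proof. by elim: b => //= l Hl r Hr; case: ifP; lia. Qed.

(** A root ear takes a leaf child that belongs to no cherry. With two leaves the root would be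
    counted both as a cherry and as a root ear. *)
Lemma ear_count_le b : 2 < leaves b ->
  cherries b + root_ear b <= (leaves b).+1./2.
Proof.
case: b => //= l r; case: ifP => [/eqP|_]; first by lia.
have := cherries_le l; have := cherries_le r.
case: (altP (leaves l =P 1)) => [/leaves_eq1 ->|_] /=; first by lia.
by case: (altP (leaves r =P 1)) => [/leaves_eq1 ->|_] /=; lia.
Qed.

Lemma optimal_btree N : 2 < N ->
  exists b, [/\ leaves b = N,
    forall b', leaves b' = N -> diam b <= diam b'
  & forall b', leaves b' = N ->
      cherries b' + root_ear b' <= cherries b + root_ear b].
Proof.
move=> N2.
have ex : exists D, N.+1 <= size_bound D.
  exists N.*2; rewrite /size_bound doubleK expnS.
  by have := ltn_expl N (isT : 1 < 2); lia.
case: (ex_minnP ex) => D ND Dmin.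
suff [b [lb db cb]] : exists b,
    [/\ leaves b = N, diam b <= D & N.+1./2 <= cherries b + root_ear b].
  exists b; split=> // b' lb'.
    by apply: leq_trans db _; apply: Dmin; rewrite -lb' leaves_diam_bound.
  by apply: leq_trans cb; rewrite -lb'; apply: ear_count_le; lia.
have D0 : 0 < D by case: D ND {Dmin} => //; rewrite /size_bound /= expn0 expn1; lia.
(* For even [N], evenness improves [N.+1 <= size_bound D] to [N.+2 <= size_bound D], the slack
   [2 ^ 1] that [spine_tree] demands at height [D]. *)
have evenB : ~~ odd (size_bound D).
  rewrite /size_bound; have [d ->] : exists d, D - D./2 = d.+1.
    by exists (D - D./2).-1; lia.
  by rewrite !expnS; lia.
have [|||b [lb hb db cb]] := @spine_tree D D (N./2).*2.
- by lia.
- by lia.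
- by rewrite subSnn expn1; lia.
case: (boolP (odd N)) => oN; last first.
  by exists b; split=> //; [lia|rewrite cb; lia].
(* The odd leaf hangs at the root: it adds a root ear, and [height b <= D] keeps the diameter within
   [D]. *)
exists (Node Leaf b); rewrite /= lb cb; split; [lia|lia|].
by case: ifP => [/eqP|_]; lia.
Qed.

(** * Trees as triangulations *)

(* A tree with N leaves encodes a triangulation of a convex polygon with
   vertices i, ..., i + N in cyclic order: the root stands for the edge
   (i, i + N), the leaves for the other sides, and the inner nodes for the
   triangles (a, m, c), a < m < c, identified by their outer edge (a, c). *)
Fixpoint bedge b (i a c : nat) :=
  [|| (a == i) && (c == i + leaves b)
    | if b is Node l r then bedge l i a c || bedge r (i + leaves l) a c
      else false].

Fixpoint btri b (i a m c : nat) :=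
  if b is Node l r then
    [|| [&& a == i, m == i + leaves l & c == i + leaves b],
        btri l i a m c | btri r (i + leaves l) a m c]
  else false.

Lemma bedge_bounds b i a c : bedge b i a c -> [&& i <= a, a < c & c <= i + leaves b].
Proof.
elim: b i => [|l Hl r Hr] i /=; first by lia.
have := leaves_gt0 l; have := leaves_gt0 r.
by move=> ? ? /or3P[|/Hl|/Hr]; lia.
Qed.

Lemma bedge_root b i : bedge b i i (i + leaves b).
Proof. by case: b => *; rewrite /= !eqxx. Qed.

Lemma bedge_noncrossing b i a c a' c' :
  bedge b i a c -> bedge b i a' c' -> ~~ [&& a < a', a' < c & c < c'].
Proof.
elim: b i => [|l Hl r Hr] i /=; first by lia.
have := leaves_gt0 l; have := leaves_gt0 r => l0 r0.
move=> /or3P[h|h|h] /or3P[h'|h'|h'];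
  try (have := Hl _ h h'; lia); try (have := Hr _ h h'; lia);
  try (move: (bedge_bounds h)); try (move: (bedge_bounds h')); lia.
Qed.

(** If the apex of the root triangle lies strictly between [x] and [y], then one of the two lower
    sides of that triangle crosses the pair, unless the pair is the root edge. Otherwise the pair
    lies within one child. *)
Lemma bedge_maximal b i x y : i <= x -> x < y -> y <= i + leaves b ->
  bedge b i x y \/ exists a c, bedge b i a c /\
    ([&& a < x, x < c & c < y] \/ [&& x < a, a < y & y < c]).
Proof.
elim: b i => [|l Hl r Hr] i /= ix xy yi.
  by left; rewrite orbF; lia.
have root_l : bedge l i i (i + leaves l) := bedge_root l i.
have root_r : bedge r (i + leaves l) (i + leaves l) (i + leaves l + leaves r) :=
  bedge_root r _.
case: (leqP y (i + leaves l)) => yl.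
  case: (Hl i ix xy yl) => [->|[a [c [e h]]]]; first by left; rewrite orbT.
  by right; exists a, c; rewrite e orbT.
case: (leqP (i + leaves l) x) => xl.
  rewrite addnA in yi.
  case: (Hr _ xl xy yi) => [->|[a [c [e h]]]]; first by left; rewrite !orbT.
  by right; exists a, c; rewrite e !orbT.
case: (ltnP i x) => ix'.
  by right; exists i, (i + leaves l); rewrite root_l orbT; split=> //; left; lia.
case: (ltnP y (i + leaves l + leaves r)) => yr.
  right; exists (i + leaves l), (i + leaves l + leaves r).
  by rewrite root_r !orbT; split=> //; right; lia.
by left; apply/orP; left; lia.
Qed.

Lemma btri_bedge b i a m c : btri b i a m c ->
  [&& a < m, m < c, bedge b i a m, bedge b i m c & bedge b i a c].
Proof.
elim: b i => [|l Hl r Hr] i //=.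
have := leaves_gt0 l; have := leaves_gt0 r => l0 r0.
case/or3P => [/and3P[/eqP-> /eqP-> /eqP->]|/Hl|/Hr].
- by rewrite addnA !bedge_root !eqxx !orbT /=; lia.
- by case/and5P => -> -> -> -> ->; rewrite !orbT.
- by case/and5P => -> -> -> -> ->; rewrite !orbT.
Qed.

Lemma btri_bounds b i a m c : btri b i a m c ->
  [&& i <= a, a < m, m < c & c <= i + leaves b].
Proof. by case/btri_bedge/and5P=> ? ? _ _ /bedge_bounds; lia. Qed.

Lemma bedge_btri b i a c : bedge b i a c -> a.+1 < c -> exists m, btri b i a m c.
Proof.
elim: b i => [|l Hl r Hr] i /=; first by lia.
move=> /or3P[/andP[-> ->]|h|h] ac.
- by exists (i + leaves l); rewrite eqxx.
- by have [m e] := Hl _ h ac; exists m; rewrite e orbT.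
- by have [m e] := Hr _ h ac; exists m; rewrite e !orbT.
Qed.

(** The edge [(a, c)] has some apex [k]. If [k] differed from [m], either [(a, m)] would cross
    [(k, c)] or [(a, k)] would cross [(m, c)]. Hence triangles can be read off the edges alone. *)
Lemma btriP b i a m c : reflect
  [/\ a < m, m < c, bedge b i a m, bedge b i m c & bedge b i a c]
  (btri b i a m c).
Proof.
apply: (iffP idP) => [/btri_bedge/and5P//|[am mc e1 e2 e3]].
have [|k ht] := bedge_btri e3; first by lia.
case/and5P: (btri_bedge ht) => ak kc f1 f2 _.
have := bedge_noncrossing e1 f2; have := bedge_noncrossing f1 e2.
by rewrite am mc ak kc /= !andbT => ? ?; have <- : k = m by lia.
Qed.

Lemma btri_apex b i a c m m' : btri b i a m c -> btri b i a m' c -> m = m'.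
Proof.
move=> /btriP[h1 h2 e1 e2 _] /btriP[h1' h2' f1 f2 _].
by have := bedge_noncrossing e1 f2; have := bedge_noncrossing f1 e2; lia.
Qed.

(** Since a triangle is identified by its outer edge, [lower_edge a m c a' c'] says that the
    triangle on [(a', c')] is a child of [(a, m, c)]. *)
Definition lower_edge (a m c x y : nat) := (x = a /\ y = m) \/ (x = m /\ y = c).

Lemma bedge_parent b i x y : bedge b i x y -> (x, y) <> (i, i + leaves b) ->
  exists a m c, btri b i a m c /\ lower_edge a m c x y.
Proof.
elim: b i => [|l Hl r Hr] i /=; first by rewrite orbF => /andP[/eqP-> /eqP->].
have root_t : btri (Node l r) i i (i + leaves l) (i + (leaves l + leaves r)).
  by rewrite /= !eqxx.
move=> /or3P[/andP[/eqP-> /eqP->]//|h|h] _.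
- case: (altP ((x, y) =P (i, i + leaves l))) => [[-> ->]|/eqP /(Hl _ h)].
    by exists i, (i + leaves l), (i + (leaves l + leaves r)); split=> //; left.
  by move=> [a [m [c [t e]]]]; exists a, m, c; rewrite t orbT.
- case: (altP ((x, y) =P (i + leaves l, i + leaves l + leaves r)))
    => [[-> ->]|/eqP /(Hr _ h)].
    exists i, (i + leaves l), (i + (leaves l + leaves r)); split=> //; right.
    by rewrite addnA.
  by move=> [a [m [c [t e]]]]; exists a, m, c; rewrite t !orbT.
Qed.

Lemma btri_parent b i a m c a' m' c' x y :
  btri b i a m c -> btri b i a' m' c' ->
  lower_edge a m c x y -> lower_edge a' m' c' x y ->
  [/\ a = a', m = m' & c = c'].
Proof.
move=> /btriP[h1 h2 e1 e2 e3] /btriP[h1' h2' f1 f2 f3] l1 l2.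
have := bedge_noncrossing e3 f2; have := bedge_noncrossing f3 e2.
have := bedge_noncrossing e3 f3; have := bedge_noncrossing f3 e3.
have := bedge_noncrossing e1 f3; have := bedge_noncrossing f1 e3.
move=> *; move: l1 l2; rewrite /lower_edge => l1 l2; clear e1 e2 e3 f1 f2 f3.
suff : a = a' /\ m = m' /\ c = c' by case=> -> [-> ->].
by case: l1 l2 => [] [? ?] [] [? ?]; subst; lia.
Qed.

(** The common pair must be the outer edge of one triangle and a lower edge of the other: two outer
    edges would coincide, and by [btri_parent] an edge is a lower edge of only one triangle. *)
Lemma btri_shared_edge b i a m c a' m' c' x y :
  btri b i a m c -> btri b i a' m' c' -> (a, c) <> (a', c') ->
  x < y -> x \in [:: a; m; c] -> y \in [:: a; m; c] ->
  x \in [:: a'; m'; c'] -> y \in [:: a'; m'; c'] ->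
  lower_edge a m c a' c' \/ lower_edge a' m' c' a c.
Proof.
move=> t t' ne xy; rewrite !inE => x1 y1 x2 y2.
have /btriP[h1 h2 e1 e2 e3] := t; have /btriP[h1' h2' f1 f2 f3] := t'.
have s1 : (x = a /\ y = c) \/ lower_edge a m c x y by rewrite /lower_edge; lia.
have s2 : (x = a' /\ y = c') \/ lower_edge a' m' c' x y by rewrite /lower_edge; lia.
case: s1 s2 => [[-> ->]|l1] [[? ?]|l2]; subst=> //; [by right|by left|].
by have [? ? ?] := btri_parent t t' l1 l2; subst; case: ne.
Qed.

(** Number of inner nodes from the root to the one with outer edge [(a, c)], both included;
    comparison with the apex decides which child contains the pair. *)
Fixpoint depth b i a c :=
  if b is Node l r then
    if c <= i + leaves l then (depth l i a c).+1
    else if i + leaves l <= a then (depth r (i + leaves l) a c).+1 else 1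
  else 0.

Lemma depth_root b i : 1 < leaves b -> depth b i i (i + leaves b) = 1.
Proof.
case: b => //= l r _; have := leaves_gt0 l; have := leaves_gt0 r => l0 r0.
by do 2 (case: ifP; try lia).
Qed.

Lemma depth_parent b i a m c a' m' c' : btri b i a m c -> btri b i a' m' c' ->
  lower_edge a m c a' c' -> depth b i a' c' = (depth b i a c).+1.
Proof.
elim: b i => //= l Hl r Hr i.
have := leaves_gt0 l; have := leaves_gt0 r => l0 r0.
rewrite /lower_edge => /or3P[h|h|h] /or3P[h'|h'|h'] e.
- lia.
- have /and4P[? ? ? ?] := btri_bounds h'.
  have [-> ->] : a' = i /\ c' = i + leaves l by lia.
  case/and3P: h => /eqP-> _ /eqP ->.
  by do 3 (case: ifP => ?; try lia); rewrite depth_root //; lia.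
- have /and4P[? ? ? ?] := btri_bounds h'.
  have [-> ->] : a' = i + leaves l /\ c' = i + leaves l + leaves r by lia.
  case/and3P: h => /eqP-> _ /eqP ->.
  by do 4 (case: ifP => ?; try lia); rewrite depth_root //; lia.
- by have := btri_bounds h; lia.
- have := btri_bounds h; have := btri_bounds h' => ? ?.
  by rewrite !ifT ?(Hl _ h h' e) //; lia.
- by have := btri_bounds h; have := btri_bounds h'; lia.
- by have := btri_bounds h; lia.
- by have := btri_bounds h; have := btri_bounds h'; lia.
- have := btri_bounds h; have := btri_bounds h' => ? ?.
  by do 4 (case: ifP => ?; try lia); rewrite (Hr _ h h' e).
Qed.

Lemma exists_deepest b i : 1 < leaves b ->
  exists a m c, btri b i a m c /\ depth b i a c = height b.
Proof.
elim: b i => //= l Hl r Hr i _.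
have := leaves_gt0 l; have := leaves_gt0 r => l0 r0.
have := height_lt_leaves l; have := height_lt_leaves r => hr1 hl1.
have [e|[[e l1]|[e r1]]] : maxn (height l) (height r) = 0 \/
    maxn (height l) (height r) = height l /\ 1 < leaves l \/
    maxn (height l) (height r) = height r /\ 1 < leaves r.
  case: (ltnP 1 (leaves l)) => l1; case: (ltnP 1 (leaves r)) => r1; lia.
- exists i, (i + leaves l), (i + (leaves l + leaves r)); rewrite !eqxx e.
  by split=> //; do 2 (case: ifP => ?; try lia).
- have [a [m [c [h d]]]] := Hl i l1; exists a, m, c; rewrite h orbT e -d.
  by have := btri_bounds h; split=> //; case: ifP => ?; lia.
- have [a [m [c [h d]]]] := Hr (i + leaves l) r1; exists a, m, c.
  rewrite h !orbT e -d.
  by have := btri_bounds h; split=> //; do 2 (case: ifP => ?; try lia).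
Qed.

(** A certificate for lower bounds: along a dual walk [g] grows by at most the length of the
    walk. *)
Definition lipschitz b i (g : nat -> nat -> nat) :=
  forall a m c a' m' c', btri b i a m c -> btri b i a' m' c' ->
    lower_edge a m c a' c' -> g a c <= (g a' c').+1 /\ g a' c' <= (g a c).+1.

Lemma lipschitz_diam b i : 1 < leaves b -> exists g, lipschitz b i g /\
  exists a m c a' m' c',
    [/\ btri b i a m c, btri b i a' m' c' & g a c + diam b <= g a' c'].
Proof.
elim: b i => //= l Hl r Hr i _.
have := leaves_gt0 l; have := leaves_gt0 r => l0 r0.
have hl := height_lt_leaves l; have hr := height_lt_leaves r.
have [dl dr] := (diam_lt_leaves l, diam_lt_leaves r).
have [e|[[e l1]|[e r1]]] :
    maxn (height l + height r) (maxn (diam l) (diam r)) = height l + height r \/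
    maxn (height l + height r) (maxn (diam l) (diam r)) = diam l /\ 1 < leaves l \/
    maxn (height l + height r) (maxn (diam l) (diam r)) = diam r /\ 1 < leaves r.
  lia.
(* Signed depth, shifted by [height r] to stay in [nat]: it increases into [l] and decreases into
   [r]. Truncated subtraction does not enlarge differences, so the Lipschitz property survives. *)
- rewrite e; exists (fun a c => if c <= i + leaves l then height r + depth l i a c
    else if i + leaves l <= a then height r - depth r (i + leaves l) a c
    else height r); split.
    move=> a m c a' m' c' t t' low.
    have := depth_parent t t' low; rewrite /lower_edge in low => /=.
    have /and4P[? ? ? ?] := btri_bounds t; have /and4P[? ? ? ?] := btri_bounds t'.
    by do 4 (try (case: ifP => ?; try lia)).
  have root_t : btri (Node l r) i i (i + leaves l) (i + (leaves l + leaves r)).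
    by rewrite /= !eqxx.
  have [al [ml [cl [tl gl]]]] : exists a m c, btri (Node l r) i a m c /\
      (if c <= i + leaves l then height r + depth l i a c
       else if i + leaves l <= a then height r - depth r (i + leaves l) a c
       else height r) = height r + height l.
    case: (ltnP 1 (leaves l)) => l1.
      have [a [m [c [h d]]]] := exists_deepest i l1.
      exists a, m, c; rewrite /= h orbT -d; split=> //.
      by have := btri_bounds h; case: ifP => ?; lia.
    (* A leaf child has height 0, and the root triangle already attains the required value. *)
    exists i, (i + leaves l), (i + (leaves l + leaves r)); split=> //.
    by do 2 (case: ifP => ?; try lia).
  have [ar [mr [cr [tr gr]]]] : exists a m c, btri (Node l r) i a m c /\
      (if c <= i + leaves l then height r + depth l i a c
       else if i + leaves l <= a then height r - depth r (i + leaves l) a c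
       else height r) = 0.
    case: (ltnP 1 (leaves r)) => r1.
      have [a [m [c [h d]]]] := exists_deepest (i + leaves l) r1.
      exists a, m, c; rewrite /= h !orbT -d; split=> //.
      by have := btri_bounds h; do 2 (case: ifP => ?; try lia).
    exists i, (i + leaves l), (i + (leaves l + leaves r)); split=> //.
    by do 2 (case: ifP => ?; try lia).
  by exists ar, mr, cr, al, ml, cl; split=> //; rewrite gl gr; lia.
- have [g [gL [a [m [c [a' [m' [c' [t t' d]]]]]]]]] := Hl i l1; rewrite e.
  (* Outside [l] the potential is frozen at its value on the root triangle of [l], the only place
     where [l] is entered. *)
  exists (fun a c => if c <= i + leaves l then g a c else g i (i + leaves l)).
  split; last first.
    exists a, m, c, a', m', c'; rewrite t t' !orbT; split=> //.
    by rewrite !ifT //; [have := btri_bounds t'; lia|have := btri_bounds t; lia].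
  move=> {a m c a' m' c' t t' d} a m c a' m' c' /= /or3P[h|h|h] /or3P[h'|h'|h'] low.
  + by do 2 (case: ifP => ?; try lia).
  + have := btri_bounds h'; rewrite /lower_edge in low => ?.
    have [-> ->] : a' = i /\ c' = i + leaves l by lia.
    by rewrite leqnn; do 1 (case: ifP => ?; try lia).
  + by have := btri_bounds h'; do 2 (case: ifP => ?; try lia).
  + by have := btri_bounds h; rewrite /lower_edge in low; lia.
  + have := btri_bounds h; have := btri_bounds h' => ? ?.
    by have := gL _ _ _ _ _ _ h h' low; rewrite !ifT //; lia.
  + by have := btri_bounds h; have := btri_bounds h'; rewrite /lower_edge in low; lia.
  + by have := btri_bounds h; rewrite /lower_edge in low; lia.
  + by have := btri_bounds h; have := btri_bounds h'; rewrite /lower_edge in low; lia.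
  + have := btri_bounds h; have := btri_bounds h' => ? ?.
    by do 2 (case: ifP => ?; try lia).
- have [g [gL [a [m [c [a' [m' [c' [t t' d]]]]]]]]] := Hr (i + leaves l) r1.
  rewrite e; exists (fun a c => if i + leaves l <= a then g a c
    else g (i + leaves l) (i + leaves l + leaves r)).
  split; last first.
    exists a, m, c, a', m', c'; rewrite t t' !orbT; split=> //.
    by rewrite !ifT //; [have := btri_bounds t'; lia|have := btri_bounds t; lia].
  move=> {a m c a' m' c' t t' d} a m c a' m' c' /= /or3P[h|h|h] /or3P[h'|h'|h'] low.
  + by do 2 (case: ifP => ?; try lia).
  + by have := btri_bounds h'; do 2 (case: ifP => ?; try lia).
  + have := btri_bounds h'; rewrite /lower_edge in low => ?.
    have [-> ->] : a' = i + leaves l /\ c' = i + leaves l + leaves r by lia.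
    by rewrite leqnn; do 1 (case: ifP => ?; try lia).
  + by have := btri_bounds h; rewrite /lower_edge in low; lia.
  + have := btri_bounds h; have := btri_bounds h' => ? ?.
    by do 2 (case: ifP => ?; try lia).
  + by have := btri_bounds h; have := btri_bounds h'; rewrite /lower_edge in low; lia.
  + by have := btri_bounds h; rewrite /lower_edge in low; lia.
  + by have := btri_bounds h; have := btri_bounds h'; rewrite /lower_edge in low; lia.
  + have := btri_bounds h; have := btri_bounds h' => ? ?.
    by have := gL _ _ _ _ _ _ h h' low; rewrite !ifT //; lia.
Qed.

(** The apex below an edge [(i, j)] is the largest [k < j] joined to [i]. If [(k, j)] were missing,
    a pair crossing it could cross neither [(i, j)] nor [(i, k)], so it would start at [i] and end
    strictly between [k] and [j], against the choice of [k]. Sides of the polygon and the root edge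
    are present because nothing can cross them. *)
Lemma btree_of_maximal N (E : nat -> nat -> bool) :
  (forall a c a' c', c' <= N -> E a c -> E a' c' -> ~~ [&& a < a', a' < c & c < c']) ->
  (forall x y, x < y <= N -> ~~ E x y -> exists a c, [/\ a < c <= N, E a c &
     [&& a < x, x < c & c < y] \/ [&& x < a, a < y & y < c]]) ->
  0 < N -> exists b, leaves b = N /\ forall a c, bedge b 0 a c -> E a c.
Proof.
move=> nc mx N0.
have E0N : E 0 N by apply/negPn/negP => /mx[|a [c []]]; lia.
have Eside i : i < N -> E i i.+1 by move=> iN; apply/negPn/negP => /mx[|a [c []]]; lia.
suff sub d i j : d = j - i -> i < j <= N -> E i j ->
    exists b, leaves b = j - i /\ forall a c, bedge b i a c -> E a c.
  by have := sub N 0 N; rewrite subn0; apply; rewrite ?N0 //=.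
elim/ltn_ind: d i j => d IH i j dE ij Eij.
case: (ltnP i.+1 j) => ij1; last first.
  exists Leaf; split=> /= [|a c]; first by lia.
  by rewrite orbF => /andP[/eqP-> /eqP->]; rewrite addn1; apply: Eside; lia.
have ex : exists k, [&& i < k, k < j & E i k].
  by exists i.+1; rewrite ltnSn ij1 Eside //; lia.
have ub k : [&& i < k, k < j & E i k] -> k <= j by lia.
case: (ex_maxnP ex ub) => k /and3P[ik kj Eik] kmax.
have Ekj : E k j.
  apply/negPn/negP => /mx[|a [c [ac Eac cr]]]; first by lia.
  have ncr1 : ~~ [&& a < i, i < c & c < j] by have := nc a c i j; rewrite Eac Eij; lia.
  have ncr2 : ~~ [&& i < a, a < j & j < c] by have := nc i j a c; rewrite Eac Eij; lia.
  have ncr3 : ~~ [&& a < i, i < c & c < k] by have := nc a c i k; rewrite Eac Eik; lia.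
  have ncr4 : ~~ [&& i < a, a < k & k < c] by have := nc i k a c; rewrite Eac Eik; lia.
  have ai : a = i by lia.
  have := kmax c; rewrite -ai Eac andbT; lia.
have [||l [ll El]] := IH (k - i) _ i k erefl _ Eik; [lia|lia|].
have [||r [lr Er]] := IH (j - k) _ k j erefl _ Ekj; [lia|lia|].
exists (Node l r); rewrite /= ll lr; split=> [|a c]; first by lia.
have -> : i + (k - i) = k by lia.
have -> : i + (k - i + (j - k)) = j by lia.
by case/or3P => [/andP[/eqP-> /eqP->]|/El|/Er].
Qed.

(** * Distances and leaves in the dual tree *)

Section GraphDist.
Variables (V : finType) (e : rel V).

Definition walk_le k x y := exists p, [/\ path e x p, last x p = y & size p <= k].

Lemma graph_dist_le k x y : walk_le k x y -> k < #|V| -> graph_dist e x y <= k.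
Proof.
move=> [p [pp lp sp]] kV; apply: leq_trans sp; rewrite leqNgt; apply/negP => lt.
have := before_find 0 lt; rewrite nth_iota; last first.
  by apply: leq_trans lt _; rewrite -[X in _ <= X](size_iota 0) find_size.
rewrite add0n => /negbT/negP; apply; rewrite /has_walk.
apply/existsP; exists (in_tuple p) => /=.
by rewrite pp lp eqxx.
Qed.

(** The bound on [k] covers an unreachable [y], whose distance is [#|V|] by convention. *)
Lemma graph_dist_ge k x y : k <= #|V| ->
  (forall p, path e x p -> last x p = y -> k <= size p) -> k <= graph_dist e x y.
Proof.
move=> kV long; rewrite /graph_dist.
case: (boolP (has (fun k => has_walk e k x y) (iota 0 #|V|))) => [hs|/hasNfind->].
  have := nth_find 0 hs; rewrite has_find size_iota in hs.
  rewrite nth_iota // add0n /has_walk => /existsP[p /andP[pp /eqP lp]].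
  by rewrite -[X in _ <= X](size_tuple p); apply: long.
by rewrite size_iota.
Qed.

Lemma walk_le_refl x : walk_le 0 x x.
Proof. by exists [::]. Qed.

Lemma walk_le_trans y k k' x z :
  walk_le k x y -> walk_le k' y z -> walk_le (k + k') x z.
Proof.
move=> [p [pp lp sp]] [q [pq lq sq]]; exists (p ++ q).
by rewrite cat_path last_cat size_cat lp pp pq lq; split=> //; lia.
Qed.

Lemma walk_le1 x y : e x y -> walk_le 1 x y.
Proof. by move=> exy; exists [:: y]; rewrite /= exy. Qed.

Lemma walk_leW k k' x y : k <= k' -> walk_le k x y -> walk_le k' x y.
Proof. by move=> kk [p [? ? ?]]; exists p; split=> //; lia. Qed.

Lemma walk_le_sym k x y : symmetric e -> walk_le k x y -> walk_le k y x.
Proof.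
move=> es [p [pp lp sp]]; exists (rev (belast x p)); split.
- rewrite -lp rev_path; apply: sub_path pp => u w /=; by rewrite es.
- by case: p pp lp sp => //= u p _ _ _; rewrite rev_cons last_rcons.
- by rewrite size_rev size_belast.
Qed.

End GraphDist.

(** A cherry is a triangle on three consecutive labels, so its first label names it. *)
Fixpoint cherry_seq b i :=
  if b is Node l r then
    if leaves l + leaves r == 2 then [:: i]
    else cherry_seq l i ++ cherry_seq r (i + leaves l)
  else [::].

Lemma size_cherry_seq b i : size (cherry_seq b i) = cherries b.
Proof.
by elim: b i => //= l Hl r Hr i; case: ifP => // _; rewrite size_cat Hl Hr.
Qed.

Lemma mem_cherry_seq b i a : (a \in cherry_seq b i) = btri b i a a.+1 a.+2.
Proof.
elim: b i => //= l Hl r Hr i; have := leaves_gt0 l; have := leaves_gt0 r => r0 l0.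
case: ifP => [/eqP e|e]; last first.
  rewrite mem_cat Hl Hr; suff -> : [&& a == i, a.+1 == i + leaves l
    & a.+2 == i + (leaves l + leaves r)] = false by [].
  lia.
have -> : l = Leaf by apply: leaves_eq1; lia.
have -> : r = Leaf by apply: leaves_eq1; lia.
by rewrite inE /=; lia.
Qed.

Lemma uniq_cherry_seq b i : uniq (cherry_seq b i).
Proof.
elim: b i => //= l Hl r Hr i; case: ifP => // _.
rewrite cat_uniq Hl Hr andbT /=; apply/hasPn => a.
rewrite !mem_cherry_seq => h; apply/negP => h'.
by have := btri_bounds h; have := btri_bounds h'; lia.
Qed.

(** * Graphs whose adjacency is the parent-child relation of a binary tree *)

Section TreeGraph.
Variables (V : finType) (e : rel V) (W : {set V}).
Variables (b : btree) (F : nat -> nat -> nat -> V).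
Hypothesis WP : forall x, x \in W <-> exists a m c, btri b 0 a m c /\ x = F a m c.
Hypothesis F_inj : forall a m c a' m' c', btri b 0 a m c -> btri b 0 a' m' c' ->
  F a m c = F a' m' c' -> [/\ a = a', m = m' & c = c'].
Hypothesis eW : forall x y, e x y -> x \in W /\ y \in W.
Hypothesis eP : forall a m c a' m' c', btri b 0 a m c -> btri b 0 a' m' c' ->
  e (F a m c) (F a' m' c') <-> lower_edge a m c a' c' \/ lower_edge a' m' c' a c.

Let e_sym : symmetric e.
Proof.
suff im x y : e x y -> e y x by move=> x y; apply/idP/idP; exact: im.
move=> exy; have [/WP [a [m [c [t ?]]]] /WP [a' [m' [c' [t' ?]]]]] := eW exy.
by subst; apply/(eP t' t); case/(eP t t'): exy => h; [right|left].
Qed.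

Lemma walk_from_root t i a m c :
  (forall a m c, btri t i a m c -> btri b 0 a m c) -> btri t i a m c ->
  exists m0, btri t i i m0 (i + leaves t) /\
    walk_le e (height t).-1 (F i m0 (i + leaves t)) (F a m c).
Proof.
elim: t i => //= l Hl r Hr i sub h.
have := leaves_gt0 l; have := leaves_gt0 r => l0 r0.
have rt : btri b 0 i (i + leaves l) (i + (leaves l + leaves r)).
  by apply: sub; rewrite !eqxx.
exists (i + leaves l); rewrite !eqxx; split=> //.
case/or3P: h => [/and3P[/eqP-> /eqP-> /eqP->]|h|h].
- by apply: walk_leW (walk_le_refl _ _).
- have [|m0 [t0 w]] := Hl i _ h.
    by move=> a' m' c' h'; apply: sub; rewrite h' orbT.
  have tb : btri b 0 i m0 (i + leaves l) by apply: sub; rewrite t0 orbT.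
  apply: (walk_leW _ (walk_le_trans (walk_le1 _) w)); last first.
    by apply/(eP rt tb); left; left.
  by case: (l) h => //= l1 l2 _; lia.
- have [|m0 [t0 w]] := Hr (i + leaves l) _ h.
    by move=> a' m' c' h'; apply: sub; rewrite h' !orbT.
  rewrite -!addnA in t0 w.
  have tb : btri b 0 (i + leaves l) m0 (i + (leaves l + leaves r)).
    by apply: sub; rewrite t0 !orbT.
  apply: (walk_leW _ (walk_le_trans (walk_le1 _) w)); last first.
    by apply/(eP rt tb); left; right.
  by case: (r) h => //= l1 l2 _; lia.
Qed.

Lemma walk_diam t i a m c a' m' c' :
  (forall a m c, btri t i a m c -> btri b 0 a m c) ->
  btri t i a m c -> btri t i a' m' c' -> walk_le e (diam t) (F a m c) (F a' m' c').
Proof.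
elim: t i => //= l Hl r Hr i sub h h'.
have := leaves_gt0 l; have := leaves_gt0 r => l0 r0.
have subl a0 m0 c0 : btri l i a0 m0 c0 -> btri b 0 a0 m0 c0.
  by move=> t0; apply: sub; rewrite t0 orbT.
have subr a0 m0 c0 : btri r (i + leaves l) a0 m0 c0 -> btri b 0 a0 m0 c0.
  by move=> t0; apply: sub; rewrite t0 !orbT.
have rt : btri b 0 i (i + leaves l) (i + (leaves l + leaves r)).
  by apply: sub; rewrite !eqxx.
have wl a0 m0 c0 : btri l i a0 m0 c0 ->
    walk_le e (height l) (F i (i + leaves l) (i + (leaves l + leaves r))) (F a0 m0 c0).
  move=> t0; have [m1 [t1 w]] := walk_from_root subl t0.
  apply: (walk_leW _ (walk_le_trans (walk_le1 _) w)); last first.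
    by apply/(eP rt (subl _ _ _ t1)); left; left.
  by case: (l) t0 => //= *; lia.
have wr a0 m0 c0 : btri r (i + leaves l) a0 m0 c0 ->
    walk_le e (height r) (F i (i + leaves l) (i + (leaves l + leaves r))) (F a0 m0 c0).
  move=> t0; have [m1 [t1 w]] := walk_from_root subr t0.
  apply: (walk_leW _ (walk_le_trans (walk_le1 _) w)); last first.
    by apply/(eP rt (subr _ _ _ t1)); left; right; rewrite addnA.
  by case: (r) t0 => //= *; lia.
case/or3P: h => [/and3P[/eqP-> /eqP-> /eqP->]|h|h];
case/or3P: h' => [/and3P[/eqP-> /eqP-> /eqP->]|h'|h'].
- by apply: walk_leW (walk_le_refl _ _).
- by apply: walk_leW (wl _ _ _ h'); lia.
- by apply: walk_leW (wr _ _ _ h'); lia.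
- by apply: walk_leW (walk_le_sym e_sym (wl _ _ _ h)); lia.
- by apply: walk_leW (Hl i subl h h'); lia.
- apply: walk_leW (walk_le_trans (walk_le_sym e_sym (wl _ _ _ h)) (wr _ _ _ h')).
  by rewrite leq_maxl.
- by apply: walk_leW (walk_le_sym e_sym (wr _ _ _ h)); lia.
- apply: walk_leW (walk_le_trans (walk_le_sym e_sym (wr _ _ _ h)) (wl _ _ _ h')).
  by rewrite addnC leq_maxl.
- by apply: walk_leW (Hr _ subr h h'); lia.
Qed.

Lemma lipschitz_walk g a m c a' m' c' p : lipschitz b 0 g ->
  btri b 0 a m c -> btri b 0 a' m' c' ->
  path e (F a m c) p -> last (F a m c) p = F a' m' c' -> g a' c' <= g a c + size p.
Proof.
move=> gL; elim: p a m c => [|x p IH] a m c t t' /=.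
  by move=> _ /(F_inj t t')[-> _ ->]; lia.
move=> /andP[ex pp] lp; have [_ /WP [a1 [m1 [c1 [t1 xE]]]]] := eW ex.
rewrite xE in ex pp lp; have := IH _ _ _ t1 t' pp lp.
case/(eP t t1): ex => h; first by have := gL _ _ _ _ _ _ t t1 h; lia.
by have := gL _ _ _ _ _ _ t1 t h; lia.
Qed.

Lemma graph_diameter_tree : 1 < leaves b -> diam b < #|V| ->
  graph_diameter e W = diam b.
Proof.
move=> b1 dV; apply/eqP; rewrite eqn_leq; apply/andP; split.
  apply/bigmax_leqP => x /WP [a [m [c [t ->]]]].
  apply/bigmax_leqP => y /WP [a' [m' [c' [t' ->]]]].
  by apply: graph_dist_le dV; apply: walk_diam t t'.
have [g [gL [a [m [c [a' [m' [c' [t t' d]]]]]]]]] := lipschitz_diam 0 b1.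
have xW : F a m c \in W by apply/WP; exists a, m, c.
have yW : F a' m' c' \in W by apply/WP; exists a', m', c'.
apply: leq_trans (leq_trans (leq_bigmax_cond _ yW) (leq_bigmax_cond _ xW)).
apply: graph_dist_ge => [|p pp lp]; first exact: ltnW.
by have := lipschitz_walk gL t t' pp lp; lia.
Qed.

(** Neighbours correspond to the edges of the triangle that are not sides of the polygon. Exactly
    one such edge remains in two cases: the outer edge of a cherry, or a lower edge of the root
    triangle, whose outer edge is itself a side. *)
Lemma ear_iff a m c : 2 < leaves b -> btri b 0 a m c ->
  (#|[set s | e (F a m c) s]| == 1) <->
  (m = a.+1 /\ c = a.+2) \/ (a = 0 /\ c = leaves b /\ (m = 1 \/ m.+1 = leaves b)).
Proof.
move=> b2 t; have /btriP[am mc em ec ea] := t.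
have bd := btri_bounds t; rewrite add0n in bd.
split=> [/cards1P[x nx]|].
  have nb a' m' c' : btri b 0 a' m' c' ->
      lower_edge a m c a' c' \/ lower_edge a' m' c' a c -> F a' m' c' = x.
    by move=> t' /(eP t t') ee; apply/set1P; rewrite -nx inE.
  have two a1 m1 c1 a2 m2 c2 : btri b 0 a1 m1 c1 -> btri b 0 a2 m2 c2 ->
      lower_edge a m c a1 c1 \/ lower_edge a1 m1 c1 a c ->
      lower_edge a m c a2 c2 \/ lower_edge a2 m2 c2 a c -> a1 = a2 /\ c1 = c2.
    move=> t1 t2 /(nb _ _ _ t1) h1 /(nb _ _ _ t2) h2.
    by have [] := F_inj t1 t2 (etrans h1 (esym h2)).
  have parent : (a = 0 /\ c = leaves b) \/
      exists a' m' c', btri b 0 a' m' c' /\ lower_edge a' m' c' a c.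
    case: (altP ((a, c) =P (0, leaves b))) => [[-> ->]|/eqP ne]; first by left.
    by right; apply: bedge_parent.
  case: (ltnP a.+1 m) => am1; case: (ltnP m.+1 c) => mc1.
  - have [m1 t1] := bedge_btri em am1; have [m2 t2] := bedge_btri ec mc1.
    have [] := two _ _ _ _ _ _ t1 t2; rewrite /lower_edge; lia.
  - case: parent => [[? ?]|[a' [m' [c' [t' low]]]]]; first by right; lia.
    have [m1 t1] := bedge_btri em am1; have bd' := btri_bounds t'.
    have [] := two _ _ _ _ _ _ t1 t'; [by left; left|by right|].
    by rewrite /lower_edge in low; lia.
  - case: parent => [[? ?]|[a' [m' [c' [t' low]]]]]; first by right; lia.
    have [m1 t1] := bedge_btri ec mc1; have bd' := btri_bounds t'.
    have [] := two _ _ _ _ _ _ t1 t'; [by left; right|by right|].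
    by rewrite /lower_edge in low; lia.
  - by left; lia.
have nbrs s : e (F a m c) s -> exists a' m' c', [/\ btri b 0 a' m' c',
    s = F a' m' c' & lower_edge a m c a' c' \/ lower_edge a' m' c' a c].
  move=> es; have [_ /WP [a' [m' [c' [t' sE]]]]] := eW es.
  by exists a', m', c'; split=> //; apply/(eP t t'); rewrite -sE.
case=> [[mE cE]|[aE [cE h]]].
  have [|a' [m' [c' [t' low]]]] := bedge_parent ea; first by case; lia.
  apply/cards1P; exists (F a' m' c'); apply/setP => s; rewrite !inE.
  apply/idP/eqP => [/nbrs[a1 [m1 [c1 [t1 -> low1]]]]|->].
    case: low1 => low1; last by have [-> -> ->] := btri_parent t1 t' low1 low.
    by have := btri_bounds t1; rewrite /lower_edge in low1; lia.
  by apply/(eP t t'); right.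
have [x [y [t0 [xy low0]]]] : exists x y, bedge b 0 x y /\ x.+1 < y /\
    lower_edge a m c x y.
  case: h => h; first by exists m, c; split=> //; split; [lia|right].
  by exists a, m; split=> //; split; [lia|left].
have [k tk] := bedge_btri t0 xy.
apply/cards1P; exists (F x k y); apply/setP => s; rewrite !inE.
apply/idP/eqP => [/nbrs[a1 [m1 [c1 [t1 -> low1]]]]|->]; last first.
  by apply/(eP t tk); left.
have bd1 := btri_bounds t1.
have [x1 y1] : a1 = x /\ c1 = y by rewrite /lower_edge in low0 low1; lia.
by subst a1 c1; rewrite (btri_apex t1 tk).
Qed.

Lemma ear_card : 2 < leaves b ->
  #|[set t in W | #|[set s | e t s]| == 1]| = cherries b + root_ear b.
Proof.
move=> b2; have [l [r bE]] := @leaves_gt1P b (ltnW b2).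
have rt : btri b 0 0 (leaves l) (leaves b) by rewrite bE /= !eqxx.
(* The ears are counted by an explicit list; it has no duplicates because a root with more than two
   leaves is not a cherry. *)
pose es := (if root_ear b then [:: F 0 (leaves l) (leaves b)] else [::]) ++
  [seq F a a.+1 a.+2 | a <- cherry_seq b 0].
have esP x : (x \in es) = (x \in [set t in W | #|[set s | e t s]| == 1]).
  rewrite mem_cat inE; apply/orP/andP => [[]|[]].
  - case: ifP => //; rewrite {1}bE inE => /= re /eqP->; split.
      by apply/WP; exists 0, (leaves l), (leaves b).
    by apply/(ear_iff b2 rt); right; rewrite bE /=; lia.
  - case/mapP => a; rewrite mem_cherry_seq => t ->; split.
      by apply/WP; exists a, a.+1, a.+2.
    by apply/(ear_iff b2 t); left.
  - move=> /WP[a [m [c [t ->]]]] /(ear_iff b2 t) [[mE cE]|[aE [cE h]]].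
      by subst; right; apply/map_f; rewrite mem_cherry_seq.
    subst a c; have mE := btri_apex t rt; subst m; left; rewrite ifT ?inE //.
    by move: h; rewrite bE /=; lia.
have ues : uniq es.
  rewrite cat_uniq map_inj_in_uniq ?uniq_cherry_seq ?andbT; last first.
    move=> a a'; rewrite !mem_cherry_seq => t t' E.
    by have [] := F_inj t t' E.
  apply/andP; split; first by case: ifP.
  apply/hasPn => _ /mapP[a + ->]; rewrite mem_cherry_seq => t.
  case: ifP => // _; rewrite inE; apply/eqP => /(F_inj t rt)[]; lia.
rewrite -(eq_card esP) (card_uniqP ues) size_cat size_map size_cherry_seq addnC.
by congr (_ + _); case: ifP.
Qed.

End TreeGraph.

(** * Plane geometry *)

Import Order.TTheory GRing.Theory Num.Theory.
Import numFieldNormedType.Exports.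
Local Open Scope classical_set_scope.
Local Open Scope ring_scope.

(** Within the component of [x] the set [O] is open, and it is also the trace of the closed set [K],
    since [K] minus [O] lies in [G]. A nonempty clopen part of a connected set is the whole set. *)
Lemma connected_component_clopen (T : topologicalType) (G O K : set T) (x : T) :
  open O -> closed K -> connected O -> O `<=` K -> O `<=` ~` G -> K `\` O `<=` G ->
  O x -> connected_component (~` G) x = O.
Proof.
move=> oO cK conO OK OG KG Ox; rewrite eqEsubset; split; last first.
  exact: connected_component_max.
set C := connected_component _ x.
have CG : C `<=` ~` G by apply: connected_component_sub.
have xC : C x by apply: connected_component_refl; exact: OG.
have conC : connected C by apply: component_connected.
suff <- : C `&` O = C by move=> y [].
apply: conC.
- by exists x.
- by exists O.
- exists K => //; rewrite eqEsubset; split=> y [Cy hy]; split=> //; first exact: OK.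
  by apply: contrapT => nO; apply: (CG _ Cy); apply: KG.
Qed.

Section Plane.
Variable R : realType.
Implicit Types (p q r s x y z : R * R).

(** Twice the signed area of the triangle [p q x], positive when it is counterclockwise. *)
Definition orient p q x : R :=
  (q.1 - p.1) * (x.2 - p.2) - (q.2 - p.2) * (x.1 - p.1).

Lemma orient_rot p q r : orient q r p = orient p q r.
Proof. by rewrite /orient; ring. Qed.

Lemma orient_swap p q r : orient q p r = - orient p q r.
Proof. by rewrite /orient; ring. Qed.

Lemma orient_swapr p q r : orient p r q = - orient p q r.
Proof. by rewrite /orient; ring. Qed.

Lemma orientl p q : orient p q p = 0.
Proof. by rewrite /orient; ring. Qed.

Lemma orientr p q : orient p q q = 0.
Proof. by rewrite /orient; ring. Qed.

Lemma orient_sum p q r x : orient q r x + orient r p x + orient p q x = orient p q r.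
Proof. by rewrite /orient; ring. Qed.

Lemma orient_comb p q x y (a b : R) : a + b = 1 ->
  orient p q (a *: x + b *: y) = a * orient p q x + b * orient p q y.
Proof.
move=> ab; have -> : b = 1 - a by rewrite -ab; ring.
have e1 : (a *: x + (1 - a) *: y).1 = a * x.1 + (1 - a) * y.1 by [].
have e2 : (a *: x + (1 - a) *: y).2 = a * x.2 + (1 - a) * y.2 by [].
by rewrite /orient e1 e2; ring.
Qed.

Lemma barycentric p q r x : orient p q r != 0 ->
  x = (orient q r x / orient p q r) *: p + (orient r p x / orient p q r) *: q
      + (orient p q x / orient p q r) *: r.
Proof.
move=> D0; set a := orient q r x / _; set b := orient r p x / _.
set c := orient p q x / _.
have e1 : (a *: p + b *: q + c *: r).1 = a * p.1 + b * q.1 + c * r.1 by [].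
have e2 : (a *: p + b *: q + c *: r).2 = a * p.2 + b * q.2 + c * r.2 by [].
rewrite [LHS]surjective_pairing [RHS]surjective_pairing e1 e2 /a /b /c.
have f1 : orient p q r * x.1 = orient q r x * p.1 + orient r p x * q.1 + orient p q x * r.1.
  by rewrite /orient; ring.
have f2 : orient p q r * x.2 = orient q r x * p.2 + orient r p x * q.2 + orient p q x * r.2.
  by rewrite /orient; ring.
congr pair; apply: (mulfI D0); rewrite ?f1 ?f2; move: D0;
  move: (orient p q r) (orient q r x) (orient r p x) (orient p q x) => *; by field.
Qed.

Lemma continuous_orient p q : continuous (orient p q).
Proof.
move=> x; rewrite /orient.
apply: cvgB; apply: cvgM; try exact: cvg_cst; apply: cvgB; try exact: cvg_cst.
  exact: cvg_snd.
exact: cvg_fst.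
Qed.

(** Described by half-planes, so that openness follows from continuity of [orient]. The order of the
    corners matters: by [orient_sum] a clockwise triple gives the empty set. *)
Definition otri p q r : set (R * R) :=
  [set x | [/\ 0 < orient p q x, 0 < orient q r x & 0 < orient r p x]].

Definition ctri p q r : set (R * R) :=
  [set x | [/\ 0 <= orient p q x, 0 <= orient q r x & 0 <= orient r p x]].

Lemma open_otri p q r : open (otri p q r).
Proof.
have -> : otri p q r = orient p q @^-1` [set x | 0 < x] `&`
   orient q r @^-1` [set x | 0 < x] `&` orient r p @^-1` [set x | 0 < x].
  by rewrite eqEsubset; split=> x; [case|case=> [[]]].
apply: openI; first apply: openI.
all: by apply: open_comp; [move=> ? _; exact: continuous_orient|exact: open_gt].
Qed.

Lemma closed_ctri p q r : closed (ctri p q r).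
Proof.
have -> : ctri p q r = orient p q @^-1` [set x | 0 <= x] `&`
   orient q r @^-1` [set x | 0 <= x] `&` orient r p @^-1` [set x | 0 <= x].
  by rewrite eqEsubset; split=> x; [case|case=> [[]]].
apply: closedI; first apply: closedI.
all: by apply: closed_comp; [move=> ? _; exact: continuous_orient|exact: closed_ge].
Qed.

Lemma connected_otri p q r : connected (otri p q r).
Proof.
case: (pselect (exists x, otri p q r x)) => [[x0 [h1 h2 h3]]|no]; last first.
  suff -> : otri p q r = set0 by apply: connected0.
  by rewrite -subset0 => x hx; apply: no; exists x.
(* The open triangle is star-shaped about [x0], hence a union of segments with a common point. *)
pose seg (x : R * R) := (fun t : R => (1 - t) *: x0 + t *: x) @` `[0, 1].
have -> : otri p q r = \bigcup_(x in otri p q r) seg x.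
  rewrite eqEsubset; split=> [x hx|y [x [k1 k2 k3]] [t]].
    exists x => //; exists 1; first by rewrite /= in_itv /= lexx ler01.
    by rewrite subrr scale0r add0r scale1r.
  rewrite /= in_itv /= => /andP[t0 t1] <-.
  split; rewrite orient_comb ?subrK //; nra.
apply: bigcup_connected.
  exists x0 => x hx; exists 0; first by rewrite /= in_itv /= lexx ler01.
  by rewrite subr0 scale1r scale0r addr0.
move=> x hx; apply: connected_continuous_connected; first exact: segment_connected.
apply: continuous_subspaceT => t.
apply: cvgD; apply: cvgZl; last exact: cvg_id.
by apply: cvgB; [exact: cvg_cst|exact: cvg_id].
Qed.

Lemma otri_sub p q r : otri p q r `<=` ctri p q r.
Proof. by move=> x [? ? ?]; split; exact: ltW. Qed.

Lemma small_comb (A B : R) : 0 < A ->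
  exists2 e0 : R, 0 < e0 & forall e, 0 < e < e0 -> 0 < (1 - e) * A + e * B.
Proof.
move=> A0; have M0 : 0 < A + `|B| + 1 by have := normr_ge0 B; lra.
exists (A / (A + `|B| + 1)) => [|e /andP[e0]]; first exact: divr_gt0.
rewrite ltr_pdivlMr // => eA; have := ler_norm (- B); rewrite normrN => nB.
nra.
Qed.

(* Moving from a point of the open side pq towards the side of r enters the
   open triangle. *)
Lemma side_enters_otri p q r s z : orient p q z = 0 -> 0 < orient q r z ->
  0 < orient r p z -> 0 < orient p q s ->
  exists2 e : R, 0 < e < 1 & otri p q r ((1 - e) *: z + e *: s).
Proof.
move=> z0 z1 z2 s0.
have [e1 e10 h1] := small_comb (orient q r s) z1.
have [e2 e20 h2] := small_comb (orient r p s) z2.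
have lt1 : Num.min e1 (Num.min e2 1) <= e1 by rewrite ge_min lexx.
have lt2 : Num.min e1 (Num.min e2 1) <= e2 by rewrite !ge_min lexx orbT.
have lt3 : Num.min e1 (Num.min e2 1) <= 1 by rewrite !ge_min lexx !orbT.
have lt0 : 0 < Num.min e1 (Num.min e2 1) by rewrite !lt_min e10 e20 ltr01.
exists (Num.min e1 (Num.min e2 1) / 2); first by lra.
split; rewrite orient_comb ?subrK //.
- by rewrite z0 mulr0 add0r mulr_gt0 //; lra.
- by apply: h1; lra.
- by apply: h2; lra.
Qed.

Lemma interior_ctri_side p q r x : 0 < orient p q r ->
  interior (ctri p q r) x -> 0 < orient p q x.
Proof.
move=> D0 xi; have [h _ _] := interior_subset xi.
rewrite lt_neqAle h andbT; apply/eqP => x0.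
(* A point of the closed triangle on the line [pq] leaves the triangle as soon as it is pushed away
   from [r]. *)
pose f (e : R) := (1 + e) *: x + (- e) *: r.
have fc : f @ (0 : R) --> x.
  have -> : x = f 0 by rewrite /f addr0 scale1r oppr0 scale0r addr0.
  apply: cvgD; apply: cvgZl.
    by apply: cvgD; [exact: cvg_cst|exact: cvg_id].
  by apply: cvgN; exact: cvg_id.
have : \forall e \near (0 : R)^'+, ctri p q r (f e).
  by apply: cvg_within; apply: fc.
move=> nr; have : \forall e \near (0 : R)^'+, 0 < e /\ ctri p q r (f e).
  by near=> e; split; [near: e; exact: nbhs_right_gt|near: e; exact: nr].
move=> /filter_ex [e [e0 [+ _ _]]].
rewrite /f orient_comb; last by ring.
by rewrite -x0 mulr0 add0r; nra.
Unshelve. all: by end_near.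
Qed.

Lemma otri_rot p q r : otri q r p = otri p q r.
Proof. by rewrite eqEsubset; split=> x [? ? ?]; split. Qed.

Lemma ctri_rot p q r : ctri q r p = ctri p q r.
Proof. by rewrite eqEsubset; split=> x [? ? ?]; split. Qed.

Lemma interior_ctri p q r : 0 < orient p q r -> interior (ctri p q r) = otri p q r.
Proof.
move=> D0; rewrite eqEsubset; split=> [x xi|].
  split; first exact: interior_ctri_side xi.
    apply: (@interior_ctri_side _ _ p); first by rewrite (orient_rot p q r).
    by rewrite (ctri_rot p q r).
  apply: (@interior_ctri_side _ _ q).
    by rewrite (orient_rot q r p) (orient_rot p q r).
  by rewrite (ctri_rot q r p) (ctri_rot p q r).
rewrite -open_subsetE; [exact: otri_sub|exact: open_otri].
Qed.

Lemma bounded_otri p q r : bounded_set (otri p q r).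
Proof.
exists (`|p| + `|q| + `|r|); split; first exact: num_real.
move=> M ltM x [h1 h2 h3]; apply: le_trans (ltW ltM).
have D0 : 0 < orient p q r by rewrite -(orient_sum p q r x); lra.
have fr a : 0 < a -> a <= orient p q r -> forall y : R * R,
    `|(a / orient p q r) *: y| <= `|y|.
  move=> a0 aD y; rewrite normrZ ger0_norm ?divr_ge0 ?(ltW a0) ?(ltW D0) //.
  by rewrite ler_piMl // ler_pdivrMr // mul1r.
have s := orient_sum p q r x.
rewrite (barycentric x (lt0r_neq0 D0)).
apply: le_trans (ler_normD _ _) _; apply: lerD; last by apply: fr => //; lra.
apply: le_trans (ler_normD _ _) _; apply: lerD; apply: fr => //; lra.
Qed.

End Plane.

Section Hull.
Variables (R : realType) (n : nat) (v : 'I_n -> R * R).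
Implicit Types (A B : {set 'I_n}).

Lemma hull_vertex A i : i \in A -> hull v A (v i).
Proof.
move=> iA; exists (fun j => (j == i)%:R); split=> [j||].
- by rewrite ler0n.
- by rewrite (bigD1 i) //= eqxx big1 ?addr0 // => j /andP[_ /negbTE ->].
- rewrite (bigD1 i) //= eqxx scale1r big1 ?addr0 // => j /andP[_ /negbTE ->].
  by rewrite scale0r.
Qed.

Lemma hullS A B : A \subset B -> hull v A `<=` hull v B.
Proof.
move=> AB x [w [w0 w1 ->]]; exists (fun i => if i \in A then w i else 0).
have sw (V : zmodType) (f : 'I_n -> V) :
    \sum_(i in A) f i = \sum_(i in B) (if i \in A then f i else 0).
  rewrite [RHS](big_setID A) /= (finset.setIidPr AB) [X in _ = _ + X]big1 ?addr0.
    by apply: eq_bigr => i ->.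
  by move=> i; rewrite inE => /andP[/negbTE ->].
split=> [i||]; first by case: ifP.
- by rewrite -sw.
- by rewrite sw; apply: eq_bigr => i _; case: ifP; rewrite ?scale0r.
Qed.

Lemma hull_convex A x y (a b : R) : 0 <= a -> 0 <= b -> a + b = 1 ->
  hull v A x -> hull v A y -> hull v A (a *: x + b *: y).
Proof.
move=> a0 b0 ab [w [w0 w1 ->]] [w' [w0' w1' ->]].
exists (fun i => a * w i + b * w' i); split=> [i||].
- by rewrite addr_ge0 // mulr_ge0.
- by rewrite big_split /= -!mulr_sumr w1 w1' !mulr1.
- rewrite !scaler_sumr -big_split /=; apply: eq_bigr => i _.
  by rewrite !scalerA scalerDl.
Qed.

Lemma hull2P i j x : i != j -> hull v [set i; j]%SET x ->
  exists a b : R, [/\ 0 <= a, 0 <= b, a + b = 1 & x = a *: v i + b *: v j].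
Proof.
move=> ij [w [w0]]; rewrite !big_setU1 ?inE //= !big_set1 => w1 ->.
by exists (w i), (w j).
Qed.

Lemma hull3P i j k x : i != j -> i != k -> j != k ->
  hull v [set i; j; k]%SET x ->
  exists a b c : R, [/\ [/\ 0 <= a, 0 <= b & 0 <= c], a + b + c = 1 &
    x = a *: v i + b *: v j + c *: v k].
Proof.
move=> ij ik jk [w [w0]].
have -> : [set i; j; k]%SET = (i |: [set j; k])%SET by rewrite finset.setUA.
rewrite big_setU1 ?inE ?negb_or ?ij //= big_setU1 ?inE //= !big_set1.
rewrite (big_setU1 _ (_ : i \notin _)) ?inE ?negb_or ?ij //= big_setU1 ?inE //=.
by rewrite big_set1 !addrA => w1 ->; exists (w i), (w j), (w k).
Qed.

End Hull.

(** * Chords and faces of a convex polygon *)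

(** The affine dependence of four points of the plane, arranged so that all coefficients are
    positive for a counterclockwise convex quadrilateral [p q r s]; after normalization both sides
    are the intersection of its diagonals. *)
Lemma four_point_relation (R : realType) (p q r s : R * R) :
  orient q r s *: p + orient p q s *: r = orient p r s *: q + orient p q r *: s /\
  orient q r s + orient p q s = orient p r s + orient p q r.
Proof.
split; last by rewrite /orient; ring.
have e (a b : R) (x y : R * R) :
  a *: x + b *: y = (a * x.1 + b * y.1, a * x.2 + b * y.2) by [].
by rewrite !e; congr pair; rewrite /orient; ring.
Qed.

Definition edge_of n (s : nat -> 'I_n) a c : {set 'I_n} := [set s a; s c]%SET.
Definition tri_of n (s : nat -> 'I_n) a m c : {set 'I_n} := [set s a; s m; s c]%SET.

(** * Vertices, edges and triples addressed by position in cyclic order *)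

Section Labels.
Variables (n N : nat) (s : nat -> 'I_n).
Hypothesis s_inj : forall a b, (a <= N)%N -> (b <= N)%N -> s a = s b -> a = b.
Hypothesis s_surj : forall i, exists2 a, (a <= N)%N & s a = i.

Let s_eq a b : (a <= N)%N -> (b <= N)%N -> (s a == s b) = (a == b).
Proof. by move=> aN bN; apply/eqP/eqP => [/(s_inj aN bN)|->]. Qed.

Lemma mem_edge_of x a c : (x <= N)%N -> (a <= N)%N -> (c <= N)%N ->
  (s x \in edge_of s a c) = (x \in [:: a; c]).
Proof. by move=> *; rewrite !inE !s_eq. Qed.

Lemma mem_tri_of x a m c : (x <= N)%N -> (a <= N)%N -> (m <= N)%N -> (c <= N)%N ->
  (s x \in tri_of s a m c) = (x \in [:: a; m; c]).
Proof. by move=> *; rewrite !inE !s_eq // orbA. Qed.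

Lemma card_edge_of a c : (a < c <= N)%N -> #|edge_of s a c| = 2%N.
Proof. by move=> h; rewrite cards2 s_eq; lia. Qed.

Lemma card_tri_of a m c : (a < m)%N -> (m < c <= N)%N -> #|tri_of s a m c| = 3%N.
Proof.
move=> am mc; rewrite /tri_of finset.setUC cardsU1 cards2 !inE !s_eq; lia.
Qed.

Lemma card2_edge_of (e : {set 'I_n}) : #|e| = 2%N ->
  exists a c, (a < c <= N)%N /\ e = edge_of s a c.
Proof.
move=> e2; have [x [y [xy ->]]] : exists x y, x != y /\ e = [set x; y]%SET.
  by apply/cards2P; rewrite e2.
have [a aN xE] := s_surj x; have [c cN yE] := s_surj y; subst x y.
rewrite s_eq // in xy; case: (ltnP a c) => ac; first by exists a, c; rewrite ac cN.
by exists c, a; rewrite /edge_of finset.setUC aN; split=> //; lia.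
Qed.

Lemma card3_tri_of (t : {set 'I_n}) : #|t| = 3%N ->
  exists a m c, [/\ (a < m)%N, (m < c)%N, (c <= N)%N & t = tri_of s a m c].
Proof.
move=> t3; have /card_gt0P[x xt] : (0 < #|t|)%N by rewrite t3.
have /card2_edge_of[a [c [ac tD]]] : #|(t :\ x)%SET| = 2%N.
  by have := cardsD1 x t; rewrite t3 xt; lia.
have tE : t = (x |: edge_of s a c)%SET by rewrite -tD finset.setD1K.
have [k kN kE] := s_surj x; subst x.
have : s k \notin edge_of s a c by rewrite -tD !inE eqxx.
rewrite mem_edge_of ?inE; [|lia..] => kac.
case: (ltnP k a) => ka; last case: (ltnP k c) => kc.
- exists k, a, c; split; [lia|lia|lia|].
  by rewrite tE; apply/setP => i; rewrite !inE orbA.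
- exists a, k, c; split; [lia|lia|lia|].
  by rewrite tE; apply/setP => i; rewrite !inE orbCA orbA.
- exists a, c, k; split; [lia|lia|lia|].
  by rewrite tE; apply/setP => i; rewrite !inE orbC.
Qed.

Lemma edge_of_inj a c a' c' : (a < c <= N)%N -> (a' < c' <= N)%N ->
  edge_of s a c = edge_of s a' c' -> a = a' /\ c = c'.
Proof.
move=> h h' E.
have m x : (x <= N)%N -> (x \in [:: a; c]) = (x \in [:: a'; c']).
  by move=> xN; rewrite -!mem_edge_of ?E //; lia.
have := m a; have := m c; have := m a'; have := m c'; rewrite !inE; lia.
Qed.

Lemma tri_of_inj a m c a' m' c' : (a < m)%N -> (m < c <= N)%N ->
  (a' < m')%N -> (m' < c' <= N)%N ->
  tri_of s a m c = tri_of s a' m' c' -> [/\ a = a', m = m' & c = c'].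
Proof.
move=> h1 h2 h1' h2' E.
have mem x : (x <= N)%N -> (x \in [:: a; m; c]) = (x \in [:: a'; m'; c']).
  by move=> xN; rewrite -!mem_tri_of ?E //; lia.
have in1 x : (x \in [:: a; m; c]) -> x = a' \/ x = m' \/ x = c'.
  move=> h; have xN : (x <= N)%N by rewrite !inE in h; lia.
  by move: h; rewrite mem // !inE; lia.
have in2 x : (x \in [:: a'; m'; c']) -> x = a \/ x = m \/ x = c.
  move=> h; have xN : (x <= N)%N by rewrite !inE in h; lia.
  by move: h; rewrite -mem // !inE; lia.
have a1 := in1 a (mem_head _ _); have a2 := in2 a' (mem_head _ _).
have ea : a = a' by clear -a1 a2 h1 h2 h1' h2'; lia.
have c1 := in1 c; have c2 := in2 c'; rewrite !inE !eqxx !orbT in c1 c2.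
have {}c1 := c1 isT; have {}c2 := c2 isT.
have ec : c = c' by clear -c1 c2 h1 h2 h1' h2'; lia.
have m1 := in1 m; rewrite !inE !eqxx !orbT in m1; have {}m1 := m1 isT.
by split=> //; clear -m1 ea ec h1 h2 h1' h2'; lia.
Qed.

Lemma edge_of_sub_tri_of x y a m c : (x < y <= N)%N -> (a < m)%N -> (m < c <= N)%N ->
  (edge_of s x y \subset tri_of s a m c) =
  (x \in [:: a; m; c]) && (y \in [:: a; m; c]).
Proof.
by move=> h h1 h2; rewrite finset.subUset !finset.sub1set !mem_tri_of //; lia.
Qed.

End Labels.

Section Chords.
Variables (R : realType) (n N : nat) (v : 'I_n -> R * R) (s : nat -> 'I_n).
Hypothesis s_inj : forall a b, (a <= N)%N -> (b <= N)%N -> s a = s b -> a = b.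
Hypothesis s_surj : forall i, exists2 a, (a <= N)%N & s a = i.
Let u a := v (s a).
Hypothesis ccw : forall a b c, (a < b)%N -> (b < c)%N -> (c <= N)%N ->
  0 < orient (u a) (u b) (u c).

Let edge a c := edge_of s a c.
Let tri a m c := tri_of s a m c.

Lemma s_neq a b : (a < b <= N)%N -> s a != s b.
Proof. by move=> h; apply/eqP => /s_inj; lia. Qed.

Lemma orient_inside a x c : (a < x)%N -> (x < c)%N -> (c <= N)%N ->
  orient (u a) (u c) (u x) < 0.
Proof.
move=> ax xc cN; rewrite orient_swap (orient_rot (u x) (u c) (u a)).
rewrite (orient_rot (u a) (u x)) oppr_lt0.
exact: ccw.
Qed.

Lemma orient_outside a x c : (a < c)%N -> (c <= N)%N -> (x <= N)%N ->
  (x < a)%N || (c < x)%N -> 0 < orient (u a) (u c) (u x).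
Proof.
move=> ac cN xN /orP[xa|cx]; last exact: ccw.
by rewrite orient_rot; exact: ccw.
Qed.

Lemma orient_le0 a x c : (a <= x)%N -> (x <= c)%N -> (c <= N)%N ->
  orient (u a) (u c) (u x) <= 0.
Proof.
move=> ax xc cN; have [->|xa] := eqVneq x a; first by rewrite orientl.
have [->|xc'] := eqVneq x c; first by rewrite orientr.
by apply/ltW/orient_inside => //; lia.
Qed.

Lemma orient_ge0 a x c : (a < c)%N -> (c <= N)%N -> (x <= N)%N ->
  (x <= a)%N || (c <= x)%N -> 0 <= orient (u a) (u c) (u x).
Proof.
move=> ac cN xN h; have [->|xa] := eqVneq x a; first by rewrite orientl.
have [->|xc'] := eqVneq x c; first by rewrite orientr.
by apply/ltW/orient_outside => //; lia.
Qed.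

Lemma hull_edgeP a c x : (a < c <= N)%N -> hull v (edge a c) x ->
  exists p q : R, [/\ 0 <= p, 0 <= q, p + q = 1 & x = p *: u a + q *: u c].
Proof. by move=> ac; apply: hull2P; apply: s_neq. Qed.

Lemma edge_hull a c p q : 0 <= p -> 0 <= q -> p + q = 1 ->
  hull v (edge a c) (p *: u a + q *: u c).
Proof.
by move=> p0 q0 pq; apply: hull_convex => //; apply: hull_vertex; rewrite !inE eqxx ?orbT.
Qed.

Lemma crossing_point a c b d : (a < c)%N -> (c < b)%N -> (b < d)%N -> (d <= N)%N ->
  exists z p q p' q', [/\ [/\ 0 < p, 0 < q, 0 < p' & 0 < q'], p + q = 1, p' + q' = 1,
    z = p *: u a + q *: u b & z = p' *: u c + q' *: u d].
Proof.
move=> ac cb bd dN.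
have [E S] := four_point_relation (u a) (u c) (u b) (u d).
have h1 : 0 < orient (u c) (u b) (u d) by apply: ccw.
have h2 : 0 < orient (u a) (u c) (u d) by apply: ccw => //; lia.
have h3 : 0 < orient (u a) (u b) (u d) by apply: ccw => //; lia.
have h4 : 0 < orient (u a) (u c) (u b) by apply: ccw => //; lia.
move: E S h1 h2 h3 h4; move: (orient (u c) (u b) (u d)) (orient (u a) (u c) (u d))
  (orient (u a) (u b) (u d)) (orient (u a) (u c) (u b)).
move=> A B C D E S A0 B0 C0 D0.
have AB0 : 0 < A + B by lra.
exists ((A + B)^-1 *: (A *: u a + B *: u b)), (A / (A + B)), (B / (A + B)),
  (C / (A + B)), (D / (A + B)); split.
- by split; apply: divr_gt0.
- by rewrite -mulrDl divff // lt0r_neq0.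
- by rewrite -mulrDl -S divff // lt0r_neq0.
- by rewrite scalerDr !scalerA !(mulrC (_^-1)).
- by rewrite E scalerDr !scalerA !(mulrC (_^-1)).
Qed.

Lemma crossing_edges_meet a c b d : (a < c)%N -> (c < b)%N -> (b < d)%N -> (d <= N)%N ->
  ~ (hull v (edge a b) `&` hull v (edge c d) `<=` v @` [set` (edge a b :&: edge c d)%SET]).
Proof.
move=> ac cb bd dN.
have [z [p [q [p' [q' [[p0 q0 p0' q0'] pq pq' zE zE']]]]]] := crossing_point ac cb bd dN.
move=> /(_ z) []; first split.
- by rewrite zE; apply: edge_hull => //; exact: ltW.
- by rewrite zE'; apply: edge_hull => //; exact: ltW.
move=> i /=; rewrite inE => /andP[].
have [x xN <-] := s_surj i.
by rewrite !(mem_edge_of s_inj) ?inE; lia.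
Qed.

Let mem_edgeI x a b c d : (x <= N)%N -> (a < b <= N)%N -> (c < d <= N)%N ->
  (s x \in edge a b :&: edge c d) = (x \in [:: a; b]) && (x \in [:: c; d]).
Proof. by move=> xN h h'; rewrite inE !(mem_edge_of s_inj) //; clear -xN h h'; lia. Qed.

(** Both [c] and [d] lie weakly on one side of the line through [a] and [b]. A common point is on
    that line, so an end of the second edge with positive weight is on it too, and then it is [a] or
    [b]. *)
Lemma noncrossing_edges_meet a b c d : (a < b <= N)%N -> (c < d <= N)%N ->
  ~~ [&& a < c, c < b & b < d]%N -> ~~ [&& c < a, a < d & d < b]%N ->
  (a, b) <> (c, d) ->
  hull v (edge a b) `&` hull v (edge c d) `<=` v @` [set` (edge a b :&: edge c d)%SET].
Proof.
move=> ab cd nc1 nc2 ne z [/(hull_edgeP ab)[p [q [p0 q0 pq zE]]]].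
move=> /(hull_edgeP cd)[p' [q' [p0' q0' pq' zE']]].
have [a_lt_b bN] := andP ab; have [c_lt_d dN] := andP cd.
have cN : (c <= N)%N := leq_trans (ltnW c_lt_d) dN.
have L0 : orient (u a) (u b) z = 0.
  by rewrite zE orient_comb // orientl orientr !mulr0 addr0.
rewrite zE' orient_comb // in L0.
have sameside : (0 <= orient (u a) (u b) (u c) /\ 0 <= orient (u a) (u b) (u d)) \/
    (orient (u a) (u b) (u c) <= 0 /\ orient (u a) (u b) (u d) <= 0).
  case: (boolP [&& a <= c, c <= b, a <= d & d <= b]%N) => [/and4P[h1 h2 h3 h4]|h].
    by right; split; apply: orient_le0.
  by left; split; apply: orient_ge0 => //; lia.
have [z1 z2] : p' * orient (u a) (u b) (u c) = 0 /\ q' * orient (u a) (u b) (u d) = 0.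
  by case: sameside => [[h1 h2]|[h1 h2]]; split; nra.
have neq0 x : (x <= N)%N -> x \notin [:: a; b] -> orient (u a) (u b) (u x) != 0.
  move=> xN; rewrite !inE => xab; case: (boolP ((a < x) && (x < b))%N) => h.
    by apply: ltr0_neq0; apply: orient_inside => //; lia.
  by apply: lt0r_neq0; apply: orient_outside => //; lia.
case: (boolP (c \in [:: a; b])) => hc; last first.
  move/eqP: z1; rewrite mulf_eq0 (negbTE (neq0 _ cN hc)) orbF.
  move=> /eqP p'0; exists (s d); last first.
    by rewrite zE' p'0 scale0r add0r; have -> : q' = 1 by [lra]; rewrite scale1r.
  rewrite /= mem_edgeI // [d \in [:: c; d]]inE mem_seq1 eqxx orbT andbT.
  case: (boolP (d \in [:: a; b])) => // hd.
  move/eqP: z2; rewrite mulf_eq0 (negbTE (neq0 _ dN hd)) orbF.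
  by move=> /eqP; lra.
case: (boolP (d \in [:: a; b])) => hd.
  by case: ne; rewrite !inE in hc hd; congr pair; lia.
move/eqP: z2; rewrite mulf_eq0 (negbTE (neq0 _ dN hd)) orbF.
move=> /eqP q'0; exists (s c); last first.
  by rewrite zE' q'0 scale0r addr0; have -> : p' = 1 by [lra]; rewrite scale1r.
by rewrite /= mem_edgeI // hc mem_head.
Qed.

Lemma hull_tri a m c : (a < m)%N -> (m < c)%N -> (c <= N)%N ->
  hull v (tri a m c) = ctri (u a) (u m) (u c).
Proof.
move=> am mc cN; have D0 := ccw am mc cN.
rewrite eqEsubset; split=> x.
  move=> /hull3P[| | |p [q [r [[p0 q0 r0] pqr xE]]]]; try (apply: s_neq; lia).
  have O y z : orient y z x = p * orient y z (u a) + q * orient y z (u m)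
                              + r * orient y z (u c).
    have pE : p = 1 - q - r by lra.
    have e1 : x.1 = p * (u a).1 + q * (u m).1 + r * (u c).1 by rewrite xE.
    have e2 : x.2 = p * (u a).2 + q * (u m).2 + r * (u c).2 by rewrite xE.
    by rewrite /orient e1 e2 pE; ring.
  split; rewrite O orientl orientr !mulr0 ?addr0 ?add0r mulr_ge0 //.
  - exact: ltW.
  - by rewrite orient_rot ltW.
  - by rewrite (orient_rot (u m)) orient_rot ltW.
case=> h1 h2 h3; rewrite (barycentric x (lt0r_neq0 D0)).
have S := orient_sum (u a) (u m) (u c) x.
have S' : orient (u m) (u c) x / orient (u a) (u m) (u c)
    + orient (u c) (u a) x / orient (u a) (u m) (u c)
    + orient (u a) (u m) x / orient (u a) (u m) (u c) = 1.
  by rewrite -2!mulrDl S divff // lt0r_neq0.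
have := divr_ge0 h1 (ltW D0); have := divr_ge0 h2 (ltW D0); have := divr_ge0 h3 (ltW D0).
move: S'; set A := orient _ _ x / _; set B := orient _ _ x / _; set C := orient _ _ x / _.
move=> S' B0 A0 C0.
exists (fun i => if i == s a then A else if i == s m then B else C).
have ea : (s m == s a) = false by rewrite eq_sym; apply/negbTE/s_neq; lia.
have eb : (s c == s a) = false by rewrite eq_sym; apply/negbTE/s_neq; lia.
have ec : (s c == s m) = false by rewrite eq_sym; apply/negbTE/s_neq; lia.
have big (V : zmodType) (f : 'I_n -> V) :
    \sum_(i in tri a m c) f i = f (s a) + f (s m) + f (s c).
  rewrite /tri /tri_of -finset.setUA big_setU1 ?inE ?(eq_sym (s a)) ?ea ?eb //=.
  by rewrite big_setU1 ?inE ?(eq_sym (s m)) ?ec //= big_set1 addrA.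
split=> [i||]; first by do 2 (case: ifP => // _).
- by rewrite big /= !eqxx ea eb ec.
- by rewrite big /= !eqxx ea eb ec.
Qed.

Lemma interior_tri a m c : (a < m)%N -> (m < c)%N -> (c <= N)%N ->
  interior (hull v (tri a m c)) = otri (u a) (u m) (u c).
Proof. by move=> am mc cN; rewrite hull_tri // interior_ctri // ccw. Qed.

End Chords.

(** * Crossing-freeness, maximality and faces in terms of positions *)

Definition noncrossing n N (s : nat -> 'I_n) (T : {set {set 'I_n}}) :=
  forall a c a' c', (c' <= N)%N -> edge_of s a c \in T -> edge_of s a' c' \in T ->
    ~~ [&& a < a', a' < c & c < c']%N.

Definition saturated n N (s : nat -> 'I_n) (T : {set {set 'I_n}}) :=
  forall x y, (x < y <= N)%N -> edge_of s x y \notin T ->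
    exists a c, [/\ (a < c <= N)%N, edge_of s a c \in T &
      [&& a < x, x < c & c < y]%N \/ [&& x < a, a < y & y < c]%N].

Section Faces.
Variables (R : realType) (n N : nat) (v : 'I_n -> R * R) (s : nat -> 'I_n).
Hypothesis s_inj : forall a b, (a <= N)%N -> (b <= N)%N -> s a = s b -> a = b.
Hypothesis s_surj : forall i, exists2 a, (a <= N)%N & s a = i.
Let u a := v (s a).
Hypothesis ccw : forall a b c, (a < b)%N -> (b < c)%N -> (c <= N)%N ->
  0 < orient (u a) (u b) (u c).

Let edge a c := edge_of s a c.
Let tri a m c := tri_of s a m c.


Lemma crossing_freeP (T : {set {set 'I_n}}) :
  crossing_free_graph_in (hull v [set: 'I_n]%SET) v T <->
  (forall e, e \in T -> #|e| = 2%N) /\ noncrossing N s T.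
Proof.
split=> [[T2 _ Tm]|[T2 nc]].
  split=> // a c a' c' cN h h'; apply/negP => /and3P[aa' a'c cc'].
  apply: (crossing_edges_meet s_inj s_surj ccw aa' a'c cc' cN).
  apply: Tm => //; apply/eqP => /(edge_of_inj s_inj) []; lia.
split=> //.
  by move=> e eT; apply: hullS; apply/fintype.subsetP => i; rewrite inE.
move=> e f eT fT ef.
have [a [c [ac eE]]] := card2_edge_of s_inj s_surj (T2 e eT).
have [a' [c' [ac' fE]]] := card2_edge_of s_inj s_surj (T2 f fT).
subst e f; have [_ cN] := andP ac; have [_ cN'] := andP ac'.
have n1 := nc _ _ _ _ cN' eT fT; have n2 := nc _ _ _ _ cN fT eT.
apply: (noncrossing_edges_meet s_inj ccw ac ac' n1 n2).
by case=> ? ?; subst; rewrite eqxx in ef.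
Qed.

Lemma triangulation_saturated (T : {set {set 'I_n}}) :
  triangulation (hull v [set: 'I_n]%SET) v T ->
  saturated N s T.
Proof.
move=> [/crossing_freeP[T2 nc] mx] x y xy xyT; apply: contrapT => no.
suff : crossing_free_graph_in (hull v [set: 'I_n]%SET) v (edge x y |: T)%SET.
  by move=> /mx E; move: xyT; rewrite -E ?finset.subsetUr // !inE eqxx.
apply/crossing_freeP; split=> [e|a c a' c' c'N].
  by rewrite inE => /orP[/set1P ->|/T2 //]; exact: (card_edge_of s_inj).
have {}no a0 c0 : (a0 < c0 <= N)%N -> edge a0 c0 \in T ->
    ~~ [&& a0 < x, x < c0 & c0 < y]%N && ~~ [&& x < a0, a0 < y & y < c0]%N.
  move=> ac0 h; rewrite -negb_or; apply/negP => cr; apply: no.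
  by exists a0, c0; split=> //; apply/orP.
move=> h h'; apply/negP => cr; move: h h'; rewrite !inE.
move=> /orP[/eqP/(edge_of_inj s_inj) e1|h] /orP[/eqP/(edge_of_inj s_inj) e2|h'].
- have [] := e1 _ _; [lia|lia|]; have [] := e2 _ _; lia.
- have [] := e1 _ _; [lia|lia|] => ? ?; subst a c; have := no a' c' _ h'; lia.
- have [] := e2 _ _; [lia|lia|] => ? ?; subst a' c'; have := no a c _ h; lia.
- by have := nc _ _ _ _ c'N h h'; rewrite cr.
Qed.

Lemma triangulation_of_saturated (T : {set {set 'I_n}}) : (forall e, e \in T -> #|e| = 2%N) ->
  noncrossing N s T -> saturated N s T ->
  triangulation (hull v [set: 'I_n]%SET) v T.
Proof.
move=> T2 nc mx; split; first exact/crossing_freeP.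
move=> T' /crossing_freeP[T2' nc'] TT'; apply/eqP; rewrite finset.eqEsubset TT' andbT.
apply/fintype.subsetP => e eT'; apply/negPn/negP => eT.
have [x [y [xy eE]]] := card2_edge_of s_inj s_surj (T2' e eT'); subst e.
have [a [c [/andP[_ cN] /(fintype.subsetP TT') acT' cr]]] := mx x y xy eT.
have [_ yN] := andP xy.
have := nc' _ _ _ _ yN acT' eT'; have := nc' _ _ _ _ cN eT' acT'; lia.
Qed.

Lemma ctri_side_hull p q r x : (p < N.+1)%N -> (q < N.+1)%N ->
  0 < orient (u p) (u q) r ->
  ctri (u p) (u q) r x -> orient (u p) (u q) x = 0 -> hull v (edge p q) x.
Proof.
move=> pN qN D0 [_ h2 h3] x0; have S := orient_sum (u p) (u q) r x.
rewrite (barycentric x (lt0r_neq0 D0)) x0 mul0r scale0r addr0.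
apply: edge_hull; try (by apply: divr_ge0 => //; exact: ltW).
by rewrite -mulrDl; move: S; rewrite x0 addr0 => ->; rewrite divff // lt0r_neq0.
Qed.

(** An edge that crosses none of the three sides has both ends in one of the closed arcs cut off by
    [a], [m], [c], hence lies in the closed half-plane beyond the corresponding side. *)
Lemma otri_off_edge (T : {set {set 'I_n}}) a m c e : (a < m)%N -> (m < c)%N -> (c <= N)%N ->
  (forall e, e \in T -> #|e| = 2%N) -> noncrossing N s T ->
  edge a m \in T -> edge m c \in T -> edge a c \in T -> e \in T ->
  forall x, otri (u a) (u m) (u c) x -> ~ hull v e x.
Proof.
move=> am mc cN T2 nc h1 h2 h3 eT z [g1 g2 g3].
have [x [y [xy eE]]] := card2_edge_of s_inj s_surj (T2 e eT); subst e.
have [x_lt_y yN] := andP xy; have aN : (a <= N)%N by lia.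
have mN : (m <= N)%N by lia.
move=> /(hull_edgeP s_inj xy)[p [q [p0 q0 pq zE]]].
rewrite zE !orient_comb // in g1 g2 g3; rewrite orient_swap in g3.
rewrite (orient_swap (u a) (u c) (u y)) in g3.
have n1 := nc _ _ _ _ yN h1 eT; have n2 := nc _ _ _ _ yN h2 eT.
have n3 := nc _ _ _ _ yN h3 eT; have n4 := nc _ _ _ _ mN eT h1.
have n5 := nc _ _ _ _ cN eT h2; have n6 := nc _ _ _ _ cN eT h3.
have : [&& a <= x & y <= m]%N || [&& m <= x & y <= c]%N ||
    (((x <= a) || (c <= x)) && ((y <= a) || (c <= y)))%N.
  by clear -x_lt_y am mc n1 n2 n3 n4 n5 n6; lia.
case/orP => [/orP[|]|] /andP[k1 k2].
- have := orient_le0 ccw k1 (leq_trans (ltnW x_lt_y) k2) mN.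
  have := orient_le0 ccw (leq_trans k1 (ltnW x_lt_y)) k2 mN.
  by clear -p0 q0 g1; rewrite /u; nra.
- have := orient_le0 ccw k1 (leq_trans (ltnW x_lt_y) k2) cN.
  have := orient_le0 ccw (leq_trans k1 (ltnW x_lt_y)) k2 cN.
  by clear -p0 q0 g2; rewrite /u; nra.
- have ac : (a < c)%N := ltn_trans am mc.
  have xN : (x <= N)%N := leq_trans (ltnW x_lt_y) yN.
  have := orient_ge0 ccw ac cN xN k1; have := orient_ge0 ccw ac cN yN k2.
  by clear -p0 q0 g3; rewrite /u; nra.
Qed.

(** [connected_component_clopen] applies with the closed triangle as [K]: the points it adds to the
    open triangle lie on the three sides, which are drawn. *)
Lemma triangle_bounded_face (T : {set {set 'I_n}}) a m c :
  (a < m)%N -> (m < c)%N -> (c <= N)%N ->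
  (forall e, e \in T -> #|e| = 2%N) -> noncrossing N s T ->
  edge a m \in T -> edge m c \in T -> edge a c \in T ->
  bounded_face v T (interior (hull v (tri a m c))).
Proof.
move=> am mc cN T2 nc h1 h2 h3; rewrite (interior_tri s_inj ccw) //.
have D0 := ccw am mc cN.
split; first exact: bounded_otri.
have OD : otri (u a) (u m) (u c) `<=` ~` drawing v T.
  move=> x xo [e eT]; exact: (otri_off_edge am mc cN T2 nc h1 h2 h3 eT xo).
have [x xo] : exists x, otri (u a) (u m) (u c) x.
  exists (3^-1 *: u a + 3^-1 *: u m + 3^-1 *: u c).
  have e1 : (3^-1 *: u a + 3^-1 *: u m + 3^-1 *: u c).1 =
    3^-1 * (u a).1 + 3^-1 * (u m).1 + 3^-1 * (u c).1 by [].
  have e2 : (3^-1 *: u a + 3^-1 *: u m + 3^-1 *: u c).2 =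
    3^-1 * (u a).2 + 3^-1 * (u m).2 + 3^-1 * (u c).2 by [].
  have D3 : 0 < 3^-1 * orient (u a) (u m) (u c) by rewrite mulr_gt0.
  by split; rewrite [ltRHS](_ : _ = 3^-1 * orient (u a) (u m) (u c)) //
    /orient e1 e2; field.
exists x; first exact: OD.
apply/esym/(@connected_component_clopen _ _ _ (ctri (u a) (u m) (u c))) => //.
- exact: open_otri.
- exact: closed_ctri.
- exact: connected_otri.
- exact: otri_sub.
- move=> y [yc nyo]; have [k1 k2 k3] := yc.
  have : orient (u a) (u m) y = 0 \/ orient (u m) (u c) y = 0 \/
      orient (u c) (u a) y = 0.
    apply: contrapT => /not_orP[z1 /not_orP[z2 z3]]; apply: nyo.
    by split; rewrite lt_neqAle eq_sym; apply/andP; split=> //; apply/eqP.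
  move=> [|[|]] y0.
  + by exists (edge a m) => //; apply: (@ctri_side_hull _ _ (u c)) => //; lia.
  + exists (edge m c) => //; apply: (@ctri_side_hull _ _ (u a)) => //; try lia.
    by rewrite (orient_rot (u a)).
  + exists (edge a c) => //.
    have -> : edge a c = edge c a by rewrite /edge /edge_of finset.setUC.
    apply: (@ctri_side_hull _ _ (u m)) => //; try lia.
    by rewrite (orient_rot (u m)) (orient_rot (u a)).
Qed.

End Faces.

(** * Correspondence between triangulations and binary trees *)

Section TreesOfTriangulations.
Variables (R : realType) (n N : nat) (v : 'I_n -> R * R) (s : nat -> 'I_n).
Hypothesis s_inj : forall a b, (a <= N)%N -> (b <= N)%N -> s a = s b -> a = b.
Hypothesis s_surj : forall i, exists2 a, (a <= N)%N & s a = i.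
Let u a := v (s a).
Hypothesis ccw : forall a b c, (a < b)%N -> (b < c)%N -> (c <= N)%N ->
  0 < orient (u a) (u b) (u c).

Let edge a c := edge_of s a c.
Let tri a m c := tri_of s a m c.



Lemma crossing_edge_enters p q r z w (al be : R) e : 0 < al -> 0 < be -> al + be = 1 ->
  z = al *: p + be *: q -> hull v e z -> hull v e w ->
  0 < orient p q r -> 0 < orient p q w -> exists2 y, otri p q r y & hull v e y.
Proof.
move=> al0 be0 albe zE ez ew D0 w0.
have [||||t /andP[t0 t1] yo] := @side_enters_otri _ p q r w z.
- by rewrite zE orient_comb // orientl orientr !mulr0 addr0.
- by rewrite zE orient_comb // orientl mulr0 addr0 orient_rot mulr_gt0.
- by rewrite zE orient_comb // orientr mulr0 add0r (orient_rot q) orient_rot mulr_gt0.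
- by [].
exists ((1 - t) *: z + t *: w) => //.
by apply: hull_convex ez ew; rewrite ?subrK //; lra.
Qed.

(** The crossing edge has an end strictly on each side of the missing chord, so it enters every open
    triangle erected on that chord. Both directions are stated because a counterclockwise triangle
    [(a, m, c)] runs forwards along [(a, m)] and [(m, c)] but backwards along its outer edge. *)
Lemma missing_edge_crossed (T : {set {set 'I_n}}) x y : saturated N s T ->
  (x < y <= N)%N -> edge x y \notin T -> exists2 e, e \in T & forall r,
    (0 < orient (u x) (u y) r -> exists2 z, otri (u x) (u y) r z & hull v e z) /\
    (0 < orient (u y) (u x) r -> exists2 z, otri (u y) (u x) r z & hull v e z).
Proof.
move=> sat xy exy; have [a [c [ac eT cr]]] := sat x y xy exy.
exists (edge a c) => // r; have [_ yN] := andP xy; have [_ cN] := andP ac.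
have ha : hull v (edge a c) (u a) by apply: hull_vertex; rewrite !inE eqxx.
have hc : hull v (edge a c) (u c) by apply: hull_vertex; rewrite !inE eqxx orbT.
case: cr => /and3P[l1 l2 l3].
  have [z [p' [q' [p [q [[p0' q0' p0 q0] pq' pq zE' zE]]]]]] :=
    crossing_point ccw l1 l2 l3 yN.
  have hz : hull v (edge a c) z by rewrite zE'; apply: edge_hull => //; exact: ltW.
  split=> D0.
    apply: (crossing_edge_enters p0 q0 pq zE hz ha D0).
    by apply: (orient_outside ccw) => //; lia.
  apply: (crossing_edge_enters q0 p0 _ _ hz hc D0).
  - by rewrite addrC.
  - by rewrite zE addrC.
  - by rewrite orient_swap oppr_gt0; apply: (orient_inside ccw).
have [z [p [q [p' [q' [[p0 q0 p0' q0'] pq pq' zE zE']]]]]] :=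
  crossing_point ccw l1 l2 l3 cN.
have hz : hull v (edge a c) z by rewrite zE'; apply: edge_hull => //; exact: ltW.
split=> D0.
  apply: (crossing_edge_enters p0 q0 pq zE hz hc D0).
  by apply: (orient_outside ccw) => //; lia.
apply: (crossing_edge_enters q0 p0 _ _ hz ha D0).
- by rewrite addrC.
- by rewrite zE addrC.
- by rewrite orient_swap oppr_gt0; apply: (orient_inside ccw).
Qed.

(** A missing side would be crossed by an edge entering the open triangle, whereas a face avoids the
    drawing. *)
Lemma bounded_face_edges (T : {set {set 'I_n}}) a m c : saturated N s T ->
  (a < m)%N -> (m < c)%N -> (c <= N)%N ->
  bounded_face v T (interior (hull v (tri a m c))) ->
  [/\ edge a m \in T, edge m c \in T & edge a c \in T].
Proof.
move=> sat am mc cN; rewrite (interior_tri s_inj ccw) // => -[_ [x _ E]].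
have D0 := ccw am mc cN.
have off e y : e \in T -> otri (u a) (u m) (u c) y -> ~ hull v e y.
  move=> eT; rewrite /u E => /connected_component_sub yD ye.
  by apply: yD; exists e.
split; apply/negPn/negP => /(missing_edge_crossed sat).
- case=> [|e eT /(_ (u c)) [/(_ D0) [y yo ye] _]]; first by lia.
  exact: off eT yo ye.
- case=> [|e eT /(_ (u a)) [+ _]]; first by lia.
  by rewrite orient_rot (otri_rot (u a)) => /(_ D0) [y yo ye]; exact: off eT yo ye.
- case=> [|e eT /(_ (u m)) [_ +]]; first by lia.
  rewrite (orient_rot (u m)) (orient_rot (u a)) (otri_rot (u m)) (otri_rot (u a)).
  by move=> /(_ D0) [y yo ye]; exact: off eT yo ye.
Qed.

Definition btree_edges b : {set {set 'I_n}} :=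
  [set e | [exists a : 'I_N.+1, [exists c : 'I_N.+1,
     bedge b 0 a c && (e == edge_of s a c)]]]%SET.

Section TreeTriangulation.
Variable b : btree.
Hypothesis bN : leaves b = N.

Let bedgeN a c : bedge b 0 a c -> (a < c <= N)%N.
Proof. by move/bedge_bounds; rewrite bN; lia. Qed.

Lemma btree_edgesP e : e \in btree_edges b <->
  exists a c, bedge b 0 a c /\ e = edge a c.
Proof.
rewrite inE; split=> [/existsP[a /existsP[c /andP[h /eqP ->]]]|[a [c [h ->]]]].
  by exists a, c.
have ac := bedgeN h; have aN : (a < N.+1)%N by lia.
have cN : (c < N.+1)%N by lia.
by apply/existsP; exists (Ordinal aN); apply/existsP; exists (Ordinal cN); rewrite h /=.
Qed.

Lemma edge_in_btree x y : (x < y <= N)%N -> (edge x y \in btree_edges b) = bedge b 0 x y.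
Proof.
move=> xy; apply/idP/idP => [/btree_edgesP[a [c [h /(edge_of_inj s_inj) []]]]|h].
- by [].
- exact: bedgeN.
- by move=> -> ->.
- by apply/btree_edgesP; exists x, y.
Qed.

Lemma btree_edges_card2 e : e \in btree_edges b -> #|e| = 2%N.
Proof. by move=> /btree_edgesP[a [c [/bedgeN h ->]]]; exact: (card_edge_of s_inj). Qed.

Lemma btree_noncrossing : noncrossing N s (btree_edges b).
Proof.
move=> a c a' c' c'N h h'; apply/negP => /and3P[l1 l2 l3].
rewrite !edge_in_btree in h h'; [|lia..].
by have := bedge_noncrossing h h'; rewrite l1 l2 l3.
Qed.

Lemma btree_saturated : saturated N s (btree_edges b).
Proof.
move=> x y xy; rewrite edge_in_btree // => nb.
have [||h|[a [c [h cr]]]] := @bedge_maximal b 0 x y (leq0n _); rewrite ?bN ?add0n; try lia.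
by exists a, c; split; [exact: bedgeN|rewrite edge_in_btree //; exact: bedgeN|].
Qed.

Lemma btree_triangulation : triangulation (hull v [set: 'I_n]%SET) v (btree_edges b).
Proof.
apply: (triangulation_of_saturated s_inj s_surj ccw); first exact: btree_edges_card2.
- exact: btree_noncrossing.
- exact: btree_saturated.
Qed.

Lemma btree_triangles t : t \in triangles v (btree_edges b) <->
  exists a m c, btri b 0 a m c /\ t = tri a m c.
Proof.
rewrite inE; split=> [/andP[/eqP t3 /asboolP face]|[a [m [c [h ->]]]]].
  have [a [m [c [am mc cN tE]]]] := card3_tri_of s_inj s_surj t3.
  exists a, m, c; split=> //; rewrite tE in face.
  have [h1 h2 h3] := bounded_face_edges btree_saturated am mc cN face.
  rewrite !edge_in_btree in h1 h2 h3; [|lia..].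
  exact/btriP.
have /btriP[am mc h1 h2 h3] := h; have := bedgeN h3 => ac.
rewrite (card_tri_of s_inj) // ?eqxx /=; last by lia.
apply/asboolP/(triangle_bounded_face s_inj s_surj ccw) => //.
- by lia.
- exact: btree_edges_card2.
- exact: btree_noncrossing.
- by rewrite edge_in_btree //; lia.
- by rewrite edge_in_btree //; lia.
- by rewrite edge_in_btree //; lia.
Qed.

Let btri_tri_inj a m c a' m' c' : btri b 0 a m c -> btri b 0 a' m' c' ->
  tri a m c = tri a' m' c' -> [/\ a = a', m = m' & c = c'].
Proof.
move=> /btri_bounds h /btri_bounds h'; rewrite bN in h h'.
by apply: (tri_of_inj s_inj); lia.
Qed.

Lemma btree_dual_adj a m c a' m' c' : btri b 0 a m c -> btri b 0 a' m' c' ->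
  dual_adj v (btree_edges b) (tri a m c) (tri a' m' c') <->
  lower_edge a m c a' c' \/ lower_edge a' m' c' a c.
Proof.
move=> t t'; have tT : tri a m c \in triangles v (btree_edges b).
  by apply/btree_triangles; exists a, m, c.
have t'T : tri a' m' c' \in triangles v (btree_edges b).
  by apply/btree_triangles; exists a', m', c'.
have /btriP[am mc h1 h2 h3] := t; have /btriP[am' mc' h1' h2' h3'] := t'.
have ac := bedgeN h3; have ac' := bedgeN h3'.
have [mcN mcN'] : (m < c <= N)%N /\ (m' < c' <= N)%N.
  by rewrite mc mc' /=; case/andP: ac; case/andP: ac'.
rewrite /dual_adj tT t'T /=; split.
  move=> /andP[ne /existsP[e /and3P[/btree_edgesP[x [y [exy ->]]]]]].
  have xy := bedgeN exy; have [x_lt_y _] := andP xy.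
  rewrite !(edge_of_sub_tri_of s_inj) // => /andP[x1 y1] /andP[x2 y2].
  apply: (btri_shared_edge t t' _ x_lt_y) => // -[? ?]; subst a' c'.
  by rewrite (btri_apex t t') eqxx in ne.
have sub x y a0 m0 c0 : (x < y <= N)%N -> (a0 < m0)%N -> (m0 < c0 <= N)%N ->
    lower_edge a0 m0 c0 x y \/ (x = a0 /\ y = c0) -> edge x y \subset tri a0 m0 c0.
  move=> xy am0 mc0 l; rewrite (edge_of_sub_tri_of s_inj) // !inE.
  by clear -l; rewrite /lower_edge in l; lia.
move=> low; apply/andP; split.
  apply/eqP => /(btri_tri_inj t t')[? ? ?]; subst a' m' c'.
  by clear -low am mc; rewrite /lower_edge in low; lia.
apply/existsP; case: low => low.
  exists (edge a' c'); rewrite edge_in_btree // h3' /=.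
  by rewrite !sub //; [right|left].
exists (edge a c); rewrite edge_in_btree // h3 /=.
by rewrite !sub //; [left|right].
Qed.

Let dual_adj_triangles t t' : dual_adj v (btree_edges b) t t' ->
  t \in triangles v (btree_edges b) /\ t' \in triangles v (btree_edges b).
Proof. by case/and4P. Qed.

Lemma btree_dual_diameter : (1 < N < n)%N -> dual_diameter v (btree_edges b) = diam b.
Proof.
move=> Nn; apply: (graph_diameter_tree btree_triangles btri_tri_inj dual_adj_triangles
  btree_dual_adj); first by rewrite bN; lia.
(* Dual vertices have type [{set 'I_n}], so the cut-off value of [graph_dist] is [2 ^ n], which
   exceeds [diam b]. *)
rewrite -cardsT -powersetT card_powerset cardsT card_ord.
have := diam_lt_leaves b; have := ltn_expl n (isT : 1 < 2)%N.
by rewrite bN; lia.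
Qed.

Lemma btree_ears : (2 < N)%N ->
  #|ears v (btree_edges b)| = (cherries b + root_ear b)%N.
Proof.
move=> Nn; apply: (ear_card btree_triangles btri_tri_inj dual_adj_triangles
  btree_dual_adj).
by rewrite bN.
Qed.

End TreeTriangulation.

Lemma triangulation_btree (T : {set {set 'I_n}}) : (0 < N)%N ->
  triangulation (hull v [set: 'I_n]%SET) v T ->
  exists b, leaves b = N /\ T = btree_edges b.
Proof.
move=> N0 tT; have sat := triangulation_saturated s_inj s_surj ccw tT.
have [/(crossing_freeP s_inj s_surj ccw)[_ nc] _] := tT.
have [||b [bN bT]] := @btree_of_maximal N (fun a c => edge a c \in T) _ _ N0.
- by move=> a c a' c' cN h h'; exact: nc.
- by move=> x y xy h; exact: sat.
exists b; split=> //.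
(* The edges of [b] lie in [T] and are already maximal, which forces equality. *)
have [_ mx] := btree_triangulation bN; apply: mx; first by case: tT.
by apply/fintype.subsetP => e /(btree_edgesP bN)[a [c [/bT h ->]]].
Qed.

End TreesOfTriangulations.

(** * Counterclockwise order of the vertices *)

Section ConvexPosition.
Variables (R : realType) (n : nat) (v : 'I_n -> R * R).
Hypothesis extreme : forall i, ~ hull v [set~ i]%SET (v i).

Let not_hull (A : {set 'I_n}) i : i \notin A -> ~ hull v A (v i).
Proof.
move=> iA h; apply: (@extreme i); apply: hullS h; apply/fintype.subsetP => j jA.
by rewrite !inE; apply: contraNneq iA => <-.
Qed.

Let not_between (i j k : 'I_n) (a b : R) : i != j -> i != k -> 0 <= a -> 0 <= b ->
  a + b = 1 -> v i = a *: v j + b *: v k -> False.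
Proof.
move=> ij ik a0 b0 ab E; apply: (@not_hull [set j; k]%SET i).
  by rewrite !inE negb_or ij ik.
by rewrite E; apply: hull_convex => //; apply: hull_vertex; rewrite !inE eqxx ?orbT.
Qed.

Let project_on_line (d1 d2 x y : R) : d1 * y = d2 * x ->
  x * (d1 ^+ 2 + d2 ^+ 2) = (d1 * x + d2 * y) * d1 /\
  y * (d1 ^+ 2 + d2 ^+ 2) = (d1 * x + d2 * y) * d2.
Proof.
move=> col; split.
  rewrite (_ : (d1 * x + d2 * y) * d1 = d1 ^+ 2 * x + d2 * (d1 * y)); last by ring.
  by rewrite col; ring.
rewrite (_ : (d1 * x + d2 * y) * d2 = d1 * (d2 * x) + d2 ^+ 2 * y); last by ring.
by rewrite -col; ring.
Qed.

(** Of three collinear points one lies between the other two; the coordinate [t] of [v k] along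
    [v i], [v j] tells which, according to [t < 0], [0 <= t <= 1] or [1 < t]. *)
Lemma extreme_not_collinear (i j k : 'I_n) : i != j -> i != k -> j != k ->
  orient (v i) (v j) (v k) != 0.
Proof.
move=> ij ik jk; apply/eqP => E.
pose d1 := (v j).1 - (v i).1; pose d2 := (v j).2 - (v i).2.
have col : d1 * ((v k).2 - (v i).2) = d2 * ((v k).1 - (v i).1).
  by apply/eqP; rewrite -subr_eq0; apply/eqP.
have comb (a b : R) (x y : R * R) :
  a *: x + b *: y = (a * x.1 + b * y.1, a * x.2 + b * y.2) by [].
have d0 : d1 ^+ 2 + d2 ^+ 2 != 0.
  apply/eqP => d0; have d10 : d1 = 0 by nra.
  have d20 : d2 = 0 by nra.
  apply: (@not_between i j j 1 0) => //; first by rewrite addr0.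
  rewrite scale1r scale0r addr0 [LHS]surjective_pairing [RHS]surjective_pairing.
  by congr pair; rewrite /d1 /d2 in d10 d20; lra.
(* Orthogonal projection onto [v j - v i] treats vertical lines like all others. *)
pose t := (d1 * ((v k).1 - (v i).1) + d2 * ((v k).2 - (v i).2)) / (d1 ^+ 2 + d2 ^+ 2).
have tE : t * (d1 ^+ 2 + d2 ^+ 2) = d1 * ((v k).1 - (v i).1) + d2 * ((v k).2 - (v i).2).
  by rewrite /t divfK.
have k1 : (v k).1 = (1 - t) * (v i).1 + t * (v j).1.
  suff : (v k).1 - (v i).1 = t * d1 by rewrite /d1; lra.
  by apply: (mulIf d0); rewrite mulrAC tE; case: (project_on_line col).
have k2 : (v k).2 = (1 - t) * (v i).2 + t * (v j).2.
  suff : (v k).2 - (v i).2 = t * d2 by rewrite /d2; lra.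
  by apply: (mulIf d0); rewrite mulrAC tE; case: (project_on_line col).
have [t0|t0] := ltrP t 0.
  have t1 : 0 < 1 - t by lra.
  apply: (@not_between i j k (- t / (1 - t)) (1 / (1 - t))) => //.
  - by apply: divr_ge0; lra.
  - by apply: divr_ge0; lra.
  - by rewrite -mulrDl (_ : - t + 1 = 1 - t) ?divff ?lt0r_neq0 //; ring.
  - rewrite comb [LHS]surjective_pairing k1 k2.
    by congr pair; field; rewrite lt0r_neq0.
have [t1|t1] := lerP t 1.
  apply: (@not_between k i j (1 - t) t); rewrite // 1?eq_sym //.
  - by rewrite subr_ge0.
  - by rewrite subrK.
  by rewrite comb [LHS]surjective_pairing k1 k2.
have t1' : 0 < t by lra.
apply: (@not_between j i k (1 - 1 / t) (1 / t)); rewrite // 1?eq_sym //.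
- by rewrite subr_ge0 ler_pdivrMr // mul1r ltW.
- by apply: divr_ge0; lra.
- by rewrite subrK.
- rewrite comb [LHS]surjective_pairing k1 k2.
  by congr pair; field; rewrite lt0r_neq0.
Qed.

Let not_in_triangle (i j k l : 'I_n) (a b c : R) : i != j -> i != k -> i != l ->
  0 < a -> 0 < b -> 0 < c ->
  (a + b + c) *: v i = a *: v j + b *: v k + c *: v l -> False.
Proof.
move=> ij ik il a0 b0 c0 E; apply: (@not_hull [set j; k; l]%SET i).
  by rewrite !inE !negb_or ij ik il.
have abc : a + b + c != 0 by apply: lt0r_neq0; lra.
have bc : b + c != 0 by apply: lt0r_neq0; lra.
have -> : v i = (a / (a + b + c)) *: v j + ((b + c) / (a + b + c)) *:
    ((b / (b + c)) *: v k + (c / (b + c)) *: v l).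
  apply: (scalerI abc); rewrite E !scalerDr !scalerA -addrA.
  by congr (_ *: _ + (_ *: _ + _ *: _)); field; rewrite ?abc ?bc.
apply: hull_convex; try (by apply: divr_ge0; lra).
- by rewrite -mulrDl addrA divff.
- by apply: hull_vertex; rewrite !inE eqxx.
apply: hull_convex; try (by apply: divr_ge0; lra).
- by rewrite -mulrDl divff.
- by apply: hull_vertex; rewrite !inE eqxx orbT.
- by apply: hull_vertex; rewrite !inE eqxx orbT.
Qed.

(* In the affine relation between four vertices two coefficients are
   positive and two are negative. *)
Lemma extreme_orient_trans (i j k l : 'I_n) : i != j -> i != k -> i != l ->
  j != k -> j != l -> k != l ->
  0 < orient (v i) (v j) (v k) -> 0 < orient (v i) (v k) (v l) ->
  0 < orient (v j) (v k) (v l) /\ 0 < orient (v i) (v j) (v l).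
Proof.
move=> ij ik il jk jl kl D0 B0.
have [E S] := four_point_relation (v i) (v j) (v k) (v l).
have A0 := extreme_not_collinear jk jl kl.
have C0 := extreme_not_collinear ij il jl.
move: E S A0 C0 B0 D0; move: (orient (v j) (v k) (v l)) (orient (v i) (v j) (v l))
  (orient (v i) (v k) (v l)) (orient (v i) (v j) (v k)) => A C B D E S A0 C0 B0 D0.
(* A negative [A] would put [v k] inside the triangle of the other three points; a negative [C]
   would then do the same to [v i]. *)
have [An|Ap|A00] := ltrgtP A 0; last by rewrite A00 eqxx in A0.
  exfalso; apply: (@not_in_triangle k i j l (- A) B D); rewrite // 1?eq_sym // ?oppr_gt0 //.
  have -> : - A + B + D = C by lra.
  rewrite -addrA -E addrA -scalerDl (_ : - A + A = 0) ?scale0r ?add0r //; ring.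
have [Cn|Cp|C00] := ltrgtP C 0; last by rewrite C00 eqxx in C0.
  exfalso; apply: (@not_in_triangle i j l k B D (- C)); rewrite // ?oppr_gt0 //.
  have -> : B + D - C = A by lra.
  by rewrite -E -addrA -scalerDl subrr scale0r addr0.
by [].
Qed.

(** The other vertices are sorted by angle around one vertex [i0]. The sign of [orient] gives a
    transitive comparison because an extreme point sees the others within less than a half-turn;
    this is [extreme_orient_trans], which also derives the orientation of [(a, b, c)] from those of
    [(i0, a, b)] and [(i0, b, c)]. *)
Lemma exists_ccw_order : (0 < n)%N -> exists s : nat -> 'I_n,
  [/\ forall a b, (a <= n.-1)%N -> (b <= n.-1)%N -> s a = s b -> a = b,
      forall i, exists2 a, (a <= n.-1)%N & s a = i
    & forall a b c, (a < b)%N -> (b < c)%N -> (c <= n.-1)%N ->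
        0 < orient (v (s a)) (v (s b)) (v (s c))].
Proof.
move=> n0; pose i0 := Ordinal n0.
pose le i j := (i == j) || (0 < orient (v i0) (v i) (v j)).
pose P := [pred i | i != i0].
have le_total : {in P &, total le}.
  move=> i j; rewrite !inE => iP jP; rewrite /le (eq_sym j).
  have [//|ij] /= := eqVneq i j.
  rewrite (orient_swapr (v i0) (v i)) oppr_gt0.
  have := extreme_not_collinear (i := i0) (j := i) (k := j).
  by rewrite !(eq_sym i0) => /(_ iP jP ij); rewrite neq_lt orbC.
have le_trans : {in P & &, transitive le}.
  move=> j i k; rewrite !inE => jP iP kP; rewrite /le.
  have [->//|ij] /= := eqVneq i j.
  have [<-|jk] /= := eqVneq j k; first by move=> ->; rewrite orbT.
  have [->//|ik] /= := eqVneq i k.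
  move=> h1 h2; have [] := @extreme_orient_trans i0 i j k; rewrite // 1?eq_sym //.
pose others := enum P.
pose l := i0 :: sort le others.
have ul : uniq l.
  rewrite /= sort_uniq enum_uniq andbT mem_sort mem_enum inE eqxx //.
have ml i : i \in l.
  by rewrite inE mem_sort mem_enum inE; case: eqVneq.
have sl : size l = n.
  by rewrite -(card_uniqP ul) -[RHS]card_ord; apply: eq_card => i; rewrite ml.
have pw : pairwise le (sort le others).
  have aP : all P (sort le others).
    by apply/allP => i; rewrite mem_sort mem_enum.
  rewrite -(sorted_pairwise_in le_trans aP); apply: (sort_sorted_in le_total).
  by apply/allP => i; rewrite mem_enum.
exists (nth i0 l); split.
- move=> a b aN bN /eqP; rewrite nth_uniq ?sl //; [by move/eqP|lia|lia].
- move=> i; exists (index i l); last by rewrite nth_index.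
  by have : (index i l < size l)%N by [rewrite index_mem]; rewrite sl; lia.
have lt_pair a b : (0 < a)%N -> (a < b)%N -> (b <= n.-1)%N ->
    0 < orient (v i0) (v (nth i0 l a)) (v (nth i0 l b)).
  move=> a0 ab bN.
  have : le (nth i0 l a) (nth i0 l b).
    have /pairwiseP := pw; case: a b a0 ab bN => [|a] [|b] // _ ab bN.
    by move=> /(_ i0 a b) /=; apply; rewrite ?inE; move: sl => /=; lia.
  by rewrite /le nth_uniq ?sl //; [case: eqVneq => //; lia|lia|lia].
move=> a b c ab bc cN; case: (posnP a) => [->|a0].
  by apply: lt_pair => //; lia.
have ne x y : (x < y)%N -> (y <= n.-1)%N -> nth i0 l x != nth i0 l y.
  by move=> xy yN; rewrite nth_uniq ?sl //; lia.
have h1 := lt_pair a b a0 ab (leq_trans (ltnW bc) cN).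
have h2 := lt_pair b c (leq_trans a0 (ltnW ab)) bc cN.
have n0x x : (0 < x)%N -> (x <= n.-1)%N -> i0 != nth i0 l x by exact: (ne 0%N x).
have [] // := @extreme_orient_trans i0 (nth i0 l a) (nth i0 l b) (nth i0 l c).
- by apply: n0x => //; lia.
- by apply: n0x => //; lia.
- by apply: n0x => //; lia.
- by apply: ne => //; lia.
- by apply: ne => //; lia.
- by apply: ne => //; lia.
Qed.

End ConvexPosition.

Theorem mainTheorem2 (R : realType) (n : nat) (P : set (R * R)%type)
    (v : 'I_n -> (R * R)%type) (hn : (3 < n)%N) (hP : convex_polygon P v) :
  exists T : {set {set 'I_n}},
    [/\ triangulation P v T,
        forall T' : {set {set 'I_n}}, triangulation P v T' ->
          (dual_diameter v T <= dual_diameter v T')%N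
      & forall T' : {set {set 'I_n}}, triangulation P v T' ->
          (#|ears v T'| <= #|ears v T|)%N].
Proof.
case: hP => -> extreme.
have [|s [s_inj s_surj ccw]] := exists_ccw_order extreme; first by lia.
have [|b [bN bdiam bears]] := @optimal_btree n.-1; first by lia.
have Nn : (1 < n.-1 < n)%N by lia.
have N2 : (2 < n.-1)%N by lia.
exists (btree_edges n.-1 s b); split; first exact: (btree_triangulation s_inj s_surj ccw).
- move=> T' /(triangulation_btree s_inj s_surj ccw (ltnW (ltnW N2)))[b' [bN' ->]].
  rewrite !(btree_dual_diameter s_inj s_surj ccw) //; exact: bdiam.
- move=> T' /(triangulation_btree s_inj s_surj ccw (ltnW (ltnW N2)))[b' [bN' ->]].
  rewrite !(btree_ears s_inj s_surj ccw) //; exact: bears.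
Qed.
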